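(* Let $\bar V\in\mathcal{P}_c(\mathbb{R}^n)$ and let $V$ be the Probability Vector Field $V[\mu]=\mu\otimes\bar V$. Then for every $\mu_0\in\mathcal{P}_c(\mathbb{R}^n)$ the solution $\mu(t)$ to the Cauchy problem $\dot\mu=V[\mu]$, $\mu(0)=\mu_0$, obtained as limit of Lattice Approximate Solutions is given by translation at constant speed $\bar v=\int v\,d\bar V(v)$, i.e. $\mu(t)(A)=\mu_0(A-t\bar v)$ for every Borel set $A\subset\mathbb{R}^n$.
   Context: $T\mathbb{R}^n=\mathbb{R}^n\times\mathbb{R}^n$ with points $(x,v)$, $\pi_1(x,v)=x$. $\mathcal{P}_c(X)$ is the set of Borel probability measures with compact support. A Probability Vector Field is a map $V:\mathcal{P}(\mathbb{R}^n)\to\mathcal{P}(T\mathbb{R}^n)$ with $\pi_1\#V[\mu]=\mu$; here $\mu\otimes\bar V$ is the product measure. Lattice Approximate Solutions (LAS) on $[0,T]$ with initial datum $\mu_0$: for $N\in\mathbb{N}$ let $\Delta_N=1/N$, let $x_i$ be the points of $(\mathbb{Z}^n/N^2)\cap[-N,N]^n$ and $v_j$ the points of $(\mathbb{Z}^n/N)\cap[-N,N]^n$. Set $\mu^N_0=\sum_i\mu_0(x_i+[0,N^{-2})^n)\,\delta_{x_i}$. Recursively, given $\mu^N_\ell$ supported on the points $x_i$, put $m_{ij}=V[\mu^N_\ell](\{(x_i,v): v\in v_j+[0,N^{-1})^n\})$ and, for $t\in[0,\Delta_N]$, $\mu^N(\ell\Delta_N+t)=\sum_{i,j}m_{ij}\,\delta_{x_i+t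 v_j}$, with $\mu^N_{\ell+1}=\mu^N((\ell+1)\Delta_N)$. This is considered for $N$ large enough that all mass stays within the grids on $[0,T]$. Limits of LASs as $N\to\infty$ are uniform in $t\in[0,T]$ for the 1-Wasserstein metric on $\mathbb{R}^n$; $T>0$ is arbitrary. Solution (weak sense): $\mu:[0,T]\to\mathcal{P}(\mathbb{R}^n)$ with $\mu(0)=\mu_0$ such that for every $f\in C_c^\infty(\mathbb{R}^n)$: $\int_{T\mathbb{R}^n}\nabla f(x)\cdot v\,dV[\mu(s)](x,v)$ is defined for a.e. $s$ and is $L^1$ in $s\in[0,T]$, $t\mapsto\int f\,d\mu(t)$ is absolutely continuous, and for a.e. $t$, $\frac{d}{dt}\int f\,d\mu(t)=\int_{T\mathbb{R}^n}\nabla f(x)\cdot v\,dV[\mu(t)](x,v)$. *)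

(* Defs.v *)
From HB Require Import structures.
From mathcomp Require Import all_boot all_order all_algebra.
From mathcomp Require Import all_classical all_reals all_analysis.

Set Implicit Arguments.
Unset Strict Implicit.
Unset Printing Implicit Defensive.

Import Order.TTheory GRing.Theory Num.Theory.
Import numFieldNormedType.Exports.

Local Open Scope classical_set_scope.
Local Open Scope ring_scope.

(* R^n with its Borel sigma-algebra. The library norm on 'rV[R]_n is the sup
   norm; it induces the usual topology, but distances below are Euclidean. *)
Notation Rn R n := (g_sigma_algebraType (@open 'rV[R]_n)).

Notation Pr R n := (probability (Rn R n) R).

(* T R^n = R^n * R^n; the product sigma-algebra is its Borel sigma-algebra
   since R^n is second countable. *)
Notation PrT R n := (probability (Rn R n * Rn R n)%type R).

(* Library measures take (irrelevant) values on nonmeasurable sets as well, so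
   equality of Borel measures is equality on measurable sets. *)
Definition eq_meas d (X : measurableType d) (R : realType)
    (mu nu : set X -> \bar R) : Prop :=
  forall A, measurable A -> mu A = nu A.

Definition msupport (R : realType) (n : nat) (mu : Pr R n) : set 'rV[R]_n :=
  [set x | forall U : set 'rV[R]_n, open U -> U x -> (0 < mu U)%E].

Definition compactly_supported (R : realType) (n : nat) (mu : Pr R n) : Prop :=
  compact (msupport mu).

(* The field [pvf_ext] says that [V] is a map on Borel measures, i.e., does not
   depend on the irrelevant values on nonmeasurable sets. *)
Record PVF (R : realType) (n : nat) := {
  pvf_fun :> Pr R n -> PrT R n ;
  pvf_ext : forall mu nu : Pr R n, eq_meas mu nu -> eq_meas (pvf_fun mu) (pvf_fun nu) ;
  pvf_fst : forall mu : Pr R n, eq_meas (pushforward (pvf_fun mu) fst) mu }.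

Definition prod_prob (R : realType) (n : nat) (mu Vbar : Pr R n) : PrT R n :=
  (mu \x Vbar)%E.

Section product_pvf_laws.
Context (R : realType) (n : nat) (Vbar : Pr R n).

Lemma prod_prob_ext (mu nu : Pr R n) :
  eq_meas mu nu -> eq_meas (prod_prob mu Vbar) (prod_prob nu Vbar).
Proof.
move=> munu A mA; apply: eq_measure_integral => B mB _; exact: munu.
Qed.

Lemma prod_prob_fst (mu : Pr R n) :
  eq_meas (pushforward (prod_prob mu Vbar) fst) mu.
Proof.
move=> A mA; rewrite /pushforward.
have -> : fst @^-1` A = A `*` setT :> set (Rn R n * Rn R n).
  by apply/seteqP; split=> [[x v]|[x v] []].
rewrite [LHS]product_measure1E//.
by rewrite [X in (_ * X)%E]probability_setT mule1.
Qed.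

Definition product_PVF : PVF R n :=
  {| pvf_fun := fun mu => prod_prob mu Vbar ;
     pvf_ext := prod_prob_ext ;
     pvf_fst := prod_prob_fst |}.

End product_pvf_laws.

Definition enorm (R : realType) (n : nat) (x : 'rV[R]_n) : R :=
  Num.sqrt (\sum_(k < n) x 0 k ^+ 2).

(* [ +oo ] when all couplings have infinite cost. *)
Definition W1 (R : realType) (n : nat) (mu nu : Pr R n) : \bar R :=
  ereal_inf [set (\int[g]_p (enorm (p.1 - p.2))%:E)%E | g in
    [set g : PrT R n | eq_meas (pushforward g fst) mu /\
                       eq_meas (pushforward g snd) nu]].

(* [lattice_pt i], for [i : lattice n N m], enumerates without repetition the
   points of (Z^n / m) `&` [-N, N]^n: the k-th coordinate is (i k - N m) / m
   with 0 <= i k <= 2 N m. *)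
Definition lattice (n N m : nat) : finType := {ffun 'I_n -> 'I_(2 * (N * m)).+1}.

Definition lattice_pt (R : realType) (n N m : nat) (i : lattice n N m) :
    'rV[R]_n :=
  \row_k (((i k)%:R - (N * m)%:R) / m%:R).

Definition cell (R : realType) (n : nat) (h : R) (x : 'rV[R]_n) :
    set 'rV[R]_n :=
  [set y | forall k, x 0 k <= y 0 k < x 0 k + h].

Definition xgrid (n N : nat) : finType := lattice n N (N ^ 2).
Definition vgrid (n N : nat) : finType := lattice n N N.

Definition LAS_init (R : realType) (n : nat) (mu0 : Pr R n) (N : nat)
    (A : set (Rn R n)) : \bar R :=
  (\sum_(i : xgrid n N)
    mu0 (cell (N%:R ^- 2)%R (lattice_pt R i)) * \d_(lattice_pt R i : Rn R n) A)%E.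

Definition LAS_step (R : realType) (n : nat) (V : PVF R n) (N : nat)
    (mu : Pr R n) (t : R) (A : set (Rn R n)) : \bar R :=
  (\sum_(i : xgrid n N) \sum_(j : vgrid n N)
    V mu [set p | p.1 = lattice_pt R i /\
                  cell (N%:R^-1)%R (lattice_pt R j) p.2] *
    \d_((lattice_pt R i + t *: lattice_pt R j)%R : Rn R n) A)%E.

(* The curve [mu] is the LAS with parameter [N] on [0, T]. Its values being
   probability measures, this forces the mass to stay within the grids on
   [0, T], so it only holds for the (large) N for which the LAS is defined on
   [0, T], and it determines [mu] on [0, T]. *)
Definition is_LAS (R : realType) (n : nat) (V : PVF R n) (mu0 : Pr R n) (T : R)
    (N : nat) (mu : R -> Pr R n) : Prop :=
  [/\ (0 < N)%N,
      eq_meas (mu 0) (LAS_init mu0 N)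
    & forall (l : nat) (t : R), 0 <= t <= N%:R^-1 -> l%:R / N%:R + t <= T ->
      eq_meas (mu (l%:R / N%:R + t)) (LAS_step V N (mu (l%:R / N%:R)) t)].

(* [mu] is the limit of the LASs with parameters [phi 0, phi 1, ...]. *)
Definition LAS_limit (R : realType) (n : nat) (V : PVF R n) (mu0 : Pr R n)
    (T : R) (phi : nat -> nat) (mu : R -> Pr R n) : Prop :=
  exists muN : nat -> R -> Pr R n,
    (\forall k \near \oo, is_LAS V mu0 T (phi k) (muN k)) /\
    (forall eps : R, 0 < eps -> \forall k \near \oo,
       forall t, 0 <= t <= T -> (W1 (muN k t) (mu t) <= eps%:E)%E).

Definition pd (R : realType) (n : nat) (k : 'I_n) (f : 'rV[R]_n -> R) :
    'rV[R]_n -> R :=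
  fun x => 'D_(delta_mx 0 k) f x.

Definition smooth (R : realType) (n : nat) (f : 'rV[R]_n -> R) : Prop :=
  forall s : seq 'I_n, let g := foldr (@pd R n) f s in
    continuous g /\ forall k x, derivable g x (delta_mx 0 k).

Definition test_function (R : realType) (n : nat) (f : 'rV[R]_n -> R) : Prop :=
  smooth f /\ compact (closure [set x | f x != 0]).

Definition grad_dot (R : realType) (n : nat) (f : 'rV[R]_n -> R)
    (p : Rn R n * Rn R n) : R :=
  \sum_(k < n) pd k f p.1 * p.2 0 k.

Definition abs_cont (R : realType) (a b : R) (F : R -> R) : Prop :=
  forall eps : R, 0 < eps -> exists2 delta : R, 0 < delta &
    forall (m : nat) (I : 'I_m -> R * R),
      (forall i, a <= (I i).1 /\ (I i).1 <= (I i).2 /\ (I i).2 <= b) ->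
      trivIset setT (fun i => `](I i).1, (I i).2[%classic) ->
      \sum_i ((I i).2 - (I i).1) < delta ->
      \sum_i `|F (I i).2 - F (I i).1| < eps.

(* [g] represents the L^1 class of s |-> \int grad f . v dV[mu s], which is
   only required to be defined almost everywhere. *)
Definition is_solution (R : realType) (n : nat) (V : PVF R n) (mu0 : Pr R n)
    (T : R) (mu : R -> Pr R n) : Prop :=
  eq_meas (mu 0) mu0 /\
  forall f : 'rV[R]_n -> R, test_function f ->
    let F : R -> R := fun t => \int[mu t]_x f x in
    let G : R -> R := fun t => \int[V (mu t)]_p grad_dot f p in
    [/\ {ae lebesgue_measure, forall s, s \in `[0, T] ->
          (V (mu s)).-integrable setT (EFin \o grad_dot f)},
        exists2 g : R -> R,
          lebesgue_measure.-integrable `[0, T] (EFin \o g) &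
          {ae lebesgue_measure, forall s, s \in `[0, T] -> G s = g s},
        abs_cont 0 T F
      & {ae lebesgue_measure, forall t, t \in `[0, T] ->
          is_derive t 1 F (G t)}].

Definition mean (R : realType) (n : nat) (mu : Pr R n) : 'rV[R]_n :=
  \row_k \int[mu]_v (v : 'rV[R]_n) 0 k.

(* Main.v *)
(* Couple the lattice scheme with the translation flow: run the scheme from the
   quantized initial point, with i.i.d. quantized velocities of law [Vbar], and
   move the initial point itself at constant speed [mean Vbar].  At each step of
   length 1/N the difference of the two positions receives an independent
   increment of bias at most 1/N^2 and of second moment O(1/N^2), hence its mean
   square after O(N) steps is O(1/N): this is the law of large numbers, and it
   gives the uniform convergence in W1.  Since W1-limits are unique and the
   scheme is determined by its initial law, every limit is the translation flow.
   The latter is a weak solution because the mean of [grad f . v] over [Vbar] is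
   the derivative of [f] in the direction [mean Vbar]. *)
From HB Require Import structures.
Require Import Defs.
From mathcomp Require Import all_boot all_order all_algebra finmap.
From mathcomp Require Import all_classical all_reals all_analysis.
From mathcomp Require Import measurable_realfun.
From mathcomp Require Import ring lra.
Set Implicit Arguments.
Unset Strict Implicit.
Unset Printing Implicit Defensive.
Import Order.TTheory GRing.Theory Num.Theory.
Import numFieldNormedType.Exports.
Local Open Scope classical_set_scope.
Local Open Scope ring_scope.

(** * Borel measurability in row vectors *)

(** No sequence of independent velocities is ever built. Only the joint law of the two positions is
    kept, and one step takes its product with [Vbar] and pushes forward: independence is the product
    measure, and its use is Tonelli, integrating over the fresh velocity with both positions frozen.

    The bias of the increment enters through the cross term of the square. Since
    [2 * |a| <= 1 + a ^+ 2], it costs a factor [1 + 1/N^2] per step and no first moment has to be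
    tracked. While the mean square is at most 1, this factor adds at most [1/N^2], so the growth is
    linear in the number of steps and no Gronwall estimate is needed.

    The rounding is defined on all of space, so the coupling exists for every [N]. The finite grids
    matter only when the first marginal is identified with the scheme. There, positions must be
    atoms of the lattice of mesh [1/N^2]: rounded velocities have mesh [1/N] and act for time [1/N],
    so they preserve that lattice. *)

Definition image_prob d d' (T : measurableType d) (T' : measurableType d')
    (R : realType) (P : probability T R) (f : T -> T')
    (mf : measurable_fun [set: T] f) : probability T' R :=
  let X : {mfun T >-> T'} := HB.pack f (isMeasurableFun.Build _ _ _ _ f mf) in
  distribution P X.

Lemma measurable_floor (R : realType) :
  measurable_fun [set: R] (fun r : R => (Num.floor r)%:~R : R).
Proof.
by apply: nondecreasing_measurable => // r s rs; rewrite ler_int le_floor.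
Qed.

Lemma measurable_preimage d d' (T : measurableType d) (T' : measurableType d')
  (f : T -> T') (A : set T') : measurable_fun setT f -> measurable A ->
  measurable (f @^-1` A).
Proof. by move=> mf mA; rewrite -[X in measurable X]setTI; exact: mf. Qed.

Section Borel_row_vectors.
Context (R : realType) (n : nat).

Lemma open_measurable_rV (U : set 'rV[R]_n) :
  open U -> measurable (U : set (Rn R n)).
Proof. by move=> oU; apply: sub_gen_smallest. Qed.

Lemma closed_measurable_rV (C : set 'rV[R]_n) :
  closed C -> measurable (C : set (Rn R n)).
Proof.
move=> cC; rewrite -[C]setCK; apply: measurableC.
by apply: open_measurable_rV; exact: closed_openC.
Qed.

Lemma measurable_rV1 (x : Rn R n) : measurable [set x].
Proof.
apply: closed_measurable_rV.
exact: (accessible_closed_set1 (hausdorff_accessible (@norm_hausdorff _ 'rV[R]_n))).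
Qed.

Lemma continuous_measurable_rV (f : 'rV[R]_n -> R) : continuous f ->
  measurable_fun [set: Rn R n] (f : Rn R n -> R).
Proof.
move=> cf; apply: (measurability (@RGenOpens.G R)).
  exact: RGenOpens.measurableE.
move=> _ [_ [a [b ->] <-]]; rewrite setTI.
apply: open_measurable_rV; apply: open_comp => //; exact: interval_open.
Qed.

Lemma measurable_coord k :
  measurable_fun [set: Rn R n] (fun x : Rn R n => (x : 'rV[R]_n) 0 k).
Proof. by apply: continuous_measurable_rV; exact: coord_continuous. Qed.

(** The sigma-algebra is generated by open sets, not by coordinates. The two agree by second
    countability: an open set is the countable union of the cubes with rational centre and radius
    [1/(m+1)] that it contains. *)
Lemma measurable_fun_rV d (T : measurableType d) (f : T -> Rn R n) :
  (forall k, measurable_fun [set: T] (fun t => (f t : 'rV[R]_n) 0 k)) ->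
  measurable_fun [set: T] f.
Proof.
move=> mf; apply: (@measurability _ _ T (Rn R n) _ _ (@open 'rV[R]_n)) => //.
move=> _ [U oU <-]; rewrite setTI.
pose J := ({ffun 'I_n -> rat} * nat)%type.
pose B (q : J) : set 'rV[R]_n :=
  [set x | forall k, `|x 0 k - ratr (q.1 k)| < q.2.+1%:R^-1].
pose F (q : J) : set T := if `[< B q `<=` U >] then f @^-1` B q else set0.
suff -> : f @^-1` U = \bigcup_q F q.
  apply: countable_bigcupT_measurable; first exact: countableP.
  move=> q; rewrite /F; case: ifP => // _.
  have -> : f @^-1` B q = \bigcap_(k in [set: 'I_n])
      (fun t => `|(f t : 'rV[R]_n) 0 k - ratr (q.1 k)|) @^-1` `]-oo, q.2.+1%:R^-1[.
    apply/seteqP; split=> [t Bt k _|t Bt k]; rewrite /= ?in_itv/=.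
      exact: Bt.
    by have := Bt k I; rewrite /= in_itv.
  apply: fin_bigcap_measurable => // k _.
  rewrite -[X in measurable X]setTI.
  have mg : measurable_fun [set: T]
      (fun t => `|(f t : 'rV[R]_n) 0 k - ratr (q.1 k)|).
    by apply: measurableT_comp => //; apply: measurable_funB.
  exact: mg.
apply/seteqP; split=> [t Ut|t [q _]]; last first.
  by rewrite /F; case: asboolP => // BU; exact: BU.
have /nbhs_ballP[e /= e0 eU] : nbhs (f t : 'rV[R]_n) U by exact: open_nbhs_nbhs.
(* Two points of a cube of radius [1/(m+1)] are less than [2/(m+1)] apart, so the cube around [f t]
   found below lies in the ball of radius [e]. *)
have [m me] : exists m : nat, m.+1%:R^-1 < e / 2.
  have e20 : 0 < e / 2 by rewrite divr_gt0.
  by have [m _ me] := near_infty_natSinv_lt (PosNum e20); exists m; exact: me m (leqnn m).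
have m0 : (0 : R) < m.+1%:R^-1 by rewrite invr_gt0.
have qP k : exists q : rat, `|(f t : 'rV[R]_n) 0 k - ratr q| < m.+1%:R^-1.
  have [|q] := @rat_in_itvoo R ((f t : 'rV[R]_n) 0 k - m.+1%:R^-1)
    ((f t : 'rV[R]_n) 0 k + m.+1%:R^-1).
    by rewrite ltrD2l gtrN.
  rewrite in_itv/= => /andP[q1 q2]; exists q.
  by rewrite ltr_distlC q1 q2.
pose q : J := ([ffun k => sval (cid (qP k))], m).
exists q => //; have Bt : B q (f t).
  by move=> k; rewrite ffunE; exact: (svalP (cid (qP k))).
rewrite /F; case: asboolP => // -[]; move=> y Bqy; apply: eU.
split=> // i k; rewrite (ord1 i) /ball/=.
have := Bqy k; have := Bt k; rewrite /q/= => H1 H2.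
have me2 : m.+1%:R^-1 + m.+1%:R^-1 <= e by move: me; set u := _^-1; lra.
rewrite (lt_le_trans _ me2)// (le_lt_trans _ (ltrD H1 H2))//.
by rewrite (le_trans _ (ler_normB _ _))// opprB addrA subrK.
Qed.

Lemma measurable_cell (h : R) (x : 'rV[R]_n) :
  measurable (cell h x : set (Rn R n)).
Proof.
have -> : cell h x = \bigcap_(k in [set: 'I_n])
    (fun y : 'rV[R]_n => y 0 k) @^-1` `[x 0 k, x 0 k + h[.
  apply/seteqP; split=> [y xy k _|y xy k]; rewrite /= ?in_itv/=.
    exact: xy.
  by have := xy k I; rewrite /= in_itv.
apply: fin_bigcap_measurable => // k _.
rewrite -[X in measurable X]setTI; apply: measurable_coord => //.
Qed.

Lemma measurable_fst_preimage (A : set (Rn R n)) : measurable A ->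
  measurable (fst @^-1` A : set (Rn R n * Rn R n)).
Proof. by apply: measurable_preimage; exact: measurable_fst. Qed.

Lemma measurable_snd_preimage (A : set (Rn R n)) : measurable A ->
  measurable (snd @^-1` A : set (Rn R n * Rn R n)).
Proof. by apply: measurable_preimage; exact: measurable_snd. Qed.

End Borel_row_vectors.

(** * Sets of full probability *)

Section conull_sets.
Context d (T : measurableType d) (R : realType) (P : probability T R).

Lemma prob1_setC (A : set T) : measurable A -> P A = 1%E -> P (~` A) = 0%E.
Proof. by move=> mA PA; rewrite probability_setC// PA subee. Qed.

Lemma prob1_ae (A : set T) : measurable A -> P A = 1%E ->
  {ae P, forall x, A x}.
Proof.
move=> mA PA; exists (~` A); split => //; first exact: measurableC.
exact: prob1_setC.
Qed.

Lemma prob1_subset (A B : set T) : measurable A -> measurable B ->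
  A `<=` B -> P A = 1%E -> P B = 1%E.
Proof.
move=> mA mB AB PA; apply/eqP; rewrite eq_le probability_le1//= -PA.
by apply: le_measure => //; rewrite inE.
Qed.

End conull_sets.

(** * The sup norm, and boundedness of compactly supported measures *)

Section sup_norm.
Context (R : realType) (n : nat).
Implicit Types x : 'rV[R]_n.

Lemma rV_norm_le x (e : R) : 0 <= e -> (forall k, `|x 0 k| <= e) -> `|x| <= e.
Proof.
move=> e0 xe; rewrite {1}/Num.norm/= mx_normrE.
by apply/bigmax_leP; split=> //= -[i k] _; rewrite /= (ord1 i); exact: xe.
Qed.

Lemma coord_norm_le x k : `|x 0 k| <= `|x|.
Proof.
rewrite [leRHS]/Num.norm/= mx_normrE.
exact: (le_bigmax _ (fun i : 'I_1 * 'I_n => `|x i.1 i.2|) (0, k)).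
Qed.

Lemma closed_norm_ge (M : R) : closed [set x : 'rV[R]_n | M <= `|x|].
Proof.
have /continuous_closedP cN := @norm_continuous R 'rV[R]_n.
exact: (cN [set r : R | M <= r] (@closed_ge _ _)).
Qed.

Lemma closed_norm_le (M : R) : closed [set x : 'rV[R]_n | `|x| <= M].
Proof.
have /continuous_closedP cN := @norm_continuous R 'rV[R]_n.
exact: (cN [set r : R | r <= M] (@closed_le _ _)).
Qed.

Lemma measurable_norm_lt (M : R) :
  measurable ([set x : 'rV[R]_n | `|x| < M] : set (Rn R n)).
Proof.
have -> : [set x : 'rV[R]_n | `|x| < M] = ~` [set x : 'rV[R]_n | M <= `|x|].
  by apply/seteqP; split=> x /=; rewrite ltNge => /negP.
by apply: measurableC; apply: closed_measurable_rV; exact: closed_norm_ge.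
Qed.

End sup_norm.

(** The support is defined pointwise, so it must be shown that no mass lies outside it. The region
    [M <= |x|] is a countable union of compact shells, and each shell misses the support, hence is
    covered by finitely many open null sets. *)
Lemma compactly_supported_bounded (R : realType) (n : nat) (mu : Pr R n) :
  compactly_supported mu ->
  exists2 M : R, 0 < M & mu [set x : 'rV[R]_n | `|x| < M] = 1%E.
Proof.
move=> /compact_bounded[M0 [_ M0P]].
pose M := Num.max 1 (M0 + 2).
have M_gt0 : 0 < M by rewrite lt_max ltr01.
exists M => //.
have supM x : msupport mu x -> `|x| < M.
  move=> /(M0P (M0 + 1)) => /(_ _)/le_lt_trans; apply; first by rewrite ltrDl.
  by rewrite lt_max ltrD2l ltr1n orbT.
pose K (m : nat) := [set x : 'rV[R]_n | `|x| <= M + m%:R] `&`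
  [set x : 'rV[R]_n | M <= `|x|].
have mK m : measurable (K m : set (Rn R n)).
  apply: measurableI; apply: closed_measurable_rV.
  - exact: closed_norm_le.
  - exact: closed_norm_ge.
have K0 m : mu (K m) = 0%E.
  have cK : compact (K m).
    apply: compact_closedI; last exact: closed_norm_ge.
    apply: bounded_closed_compact; last exact: closed_norm_le.
    exists (M + m%:R); split; first exact: num_real.
    by move=> x Mx y /= /le_trans; apply; exact: ltW.
  move: cK; rewrite compact_cover => cK.
  pose D := [set U : set 'rV[R]_n | open U /\ mu U = 0%E].
  have [|x [_ /= Mx]|D' D'D KD'] := cK _ D id; first by move=> U [].
    have : ~ msupport mu x by move=> /supM; rewrite ltNge Mx.
    move=> /existsNP[U] /not_implyP[oU] /not_implyP[Ux /negP].
    rewrite -leNgt => U0; exists U => //; split => //.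
    by apply/eqP; rewrite eq_le U0 measure_ge0.
  apply/eqP; rewrite eq_le measure_ge0 andbT.
  have D'P : [set` D'] `<=` D by move=> i /= /D'D; rewrite inE.
  have := @content_sub_fsum _ _ _ mu _ [set` D'] (K m) id.
  move=> /(_ (finite_fset D') _ (mK m) KD'); rewrite fsbig1.
    by apply => i /D'P[oi _]; exact: open_measurable_rV.
  by move=> i /D'P[].
have mB := @measurable_norm_lt R n M.
rewrite -[X in mu X]setCK probability_setC; last exact: measurableC.
rewrite (_ : ~` _ = \bigcup_m K m); last first.
  apply/seteqP; split=> x /=.
    move=> /negP; rewrite -leNgt => Mx; exists (Num.bound `|x|) => //; split => //=.
    rewrite (le_trans (ltW (archi_boundP (normr_ge0 x))))// lerDr ltW//.
  by move=> [m _ [_ /=]]; rewrite leNgt => /negP.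
rewrite [mu _](_ : _ = 0%E) ?sube0//.
apply/negligibleP; first exact: bigcup_measurable.
apply: (@negligible_bigcup _ _ _ mu K) => m; apply/negligibleP; [exact: mK|exact: K0].
Qed.

(** * Test functions *)

Section test_functions.
Context (R : realType) (n : nat).
Implicit Types f : 'rV[R]_n -> R.

Lemma is_derive_along f (k : 'I_n) (x : 'rV[R]_n) (s : R) :
  (forall y, derivable f y (delta_mx 0 k)) ->
  is_derive s 1 (fun r : R => f (x + r *: delta_mx 0 k))
    (pd k f (x + s *: delta_mx 0 k)).
Proof.
move=> df; pose phi r : R := f (x + r *: delta_mx 0 k).
have E : (fun h : R => h^-1 *: ((phi \o shift s) (h *: 1) - phi s)) =
  (fun h : R => h^-1 *: ((f \o shift (x + s *: delta_mx 0 k)) (h *: delta_mx 0 k)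
     - f (x + s *: delta_mx 0 k))).
  apply/funext => h; rewrite /phi /=; congr (_ *: (f _ - _)).
  by rewrite [h *: 1]mulr1 scalerDl addrCA.
apply: DeriveDef; first by rewrite /derivable E; exact: df.
by rewrite /derive E.
Qed.

Lemma mean_value_along f (k : 'I_n) (x : 'rV[R]_n) (h : R) :
  (forall y, derivable f y (delta_mx 0 k)) ->
  exists2 c : R, `|c| <= `|h| & f (x + h *: delta_mx 0 k) - f x =
    h * pd k f (x + c *: delta_mx 0 k).
Proof.
move=> df; pose phi r : R := f (x + r *: delta_mx 0 k).
have dphi (s : R) : is_derive s (1 : R) phi (pd k f (x + s *: delta_mx 0 k)).
  exact: is_derive_along.
have cphi (A : set R) : {within A, continuous phi}.
  apply: continuous_subspaceT => s; apply: differentiable_continuous.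
  by apply/derivable1_diffP; have [] := dphi s.
have phi0 : phi 0 = f x by rewrite /phi scale0r addr0.
rewrite -phi0 -/(phi h); have [h0|h0] := leP 0 h.
  have [c] := MVT_segment h0 (fun s _ => dphi s) (cphi _).
  rewrite in_itv/= => /andP[c0 ch] ->; exists c; last by rewrite subr0 mulrC.
  by rewrite !ger0_norm.
have [c] := MVT_segment (ltW h0) (fun s _ => dphi s) (cphi _).
rewrite in_itv/= => /andP[hc c0] E; exists c.
  by rewrite !ler0_norm// ?lerN2// ltW.
by apply: oppr_inj; rewrite opprB E sub0r mulrN mulrC.
Qed.

(** Only partial derivatives are at hand, so the path from [x] to [x + w] is a staircase that
    changes one coordinate at a time; the one-variable mean value theorem on each stair gives its
    own intermediate point [xi k]. *)
Lemma mean_value_rV f : (forall k y, derivable f y (delta_mx 0 k)) ->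
  forall x w : 'rV[R]_n, exists2 xi : 'I_n -> 'rV[R]_n,
    forall k, `|xi k| <= `|w| &
    f (x + w) - f x = \sum_(k < n) w 0 k * pd k f (x + xi k).
Proof.
move=> df x w.
pose W (m : nat) : 'rV[R]_n := \row_k (if (k < m)%N then w 0 k else 0).
have WS (k : 'I_n) : W k.+1 = W k + w 0 k *: delta_mx 0 k.
  apply/rowP => j; rewrite !mxE eqxx/= ltnS; have [->|jk] := eqVneq j k.
    by rewrite leqnn ltnn mulr1 add0r.
  by rewrite mulr0 addr0 leq_eqVlt (negbTE (jk : (j : nat) != k)).
have : forall k : 'I_n, exists c, `|c| <= `|w 0 k| /\
    f (x + W k.+1) - f (x + W k) = w 0 k * pd k f (x + W k + c *: delta_mx 0 k).
  move=> k; have [c cw E] := mean_value_along (x + W k) (w 0 k) (df k).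
  by exists c; split=> //; rewrite -E WS addrA.
(* The [k]-th coordinate of [W k] is still 0, so each coordinate of this point is bounded by the
   corresponding one of [w]: in the sup norm the staircase stays within [|w|]. *)
move=> /choice[c cP]; exists (fun k : 'I_n => W k + c k *: delta_mx 0 k).
  move=> k; apply: rV_norm_le => // j; rewrite !mxE eqxx/=.
  have [->|jk] := eqVneq j k.
    rewrite ltnn add0r mulr1 (le_trans (cP k).1)//; exact: coord_norm_le.
  rewrite mulr0 addr0; case: ifP => _; first exact: coord_norm_le.
  by rewrite normr0.
under eq_bigr => k _ do rewrite addrA -(cP k).2.
rewrite -(big_mkord xpredT (fun k => f (x + W k.+1) - f (x + W k))).
rewrite telescope_sumr//; congr (f (_ + _) - f _).
  by apply/rowP => k; rewrite mxE ltn_ord.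
by rewrite -[LHS]addr0; congr (_ + _); apply/rowP => k; rewrite !mxE ltn0.
Qed.

Lemma test_function_continuous f : test_function f -> continuous f.
Proof. by move=> [/(_ [::])[]]. Qed.

Lemma test_function_derivable f : test_function f ->
  forall k y, derivable f y (delta_mx 0 k).
Proof. by move=> [/(_ [::])[]]. Qed.

(** Off the closed support, [f] coincides with 0 on a neighbourhood, so its partial derivative
    vanishes there and the support does not grow. *)
Lemma test_function_pd f k : test_function f -> test_function (pd k f).
Proof.
move=> [sf cf]; split=> [s|]; first by have := sf (rcons s k); rewrite foldr_rcons.
set K := closure _ in cf; have cK : closed K by exact: closed_closure.
apply: subclosed_compact cf _; first exact: closed_closure.
have KK : closure K `<=` K by rewrite -(closure_id K).1.
apply: subset_trans KK; apply: closure_subset => x /= fx0.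
apply: contrapT => nKx; move/eqP: fx0; apply.
rewrite /pd -[RHS](@derive_cst R 'rV[R]_n R 0 (x : 'rV[R]_n) 'e_k).
apply: near_eq_derive.
have : nbhs x (~` K) by apply: open_nbhs_nbhs; split=> //; exact: closed_openC.
apply: filterS => y nKy; apply: contrapT => /eqP fy0; apply: nKy.
exact: subset_closure.
Qed.

Lemma test_function_bounded f : test_function f ->
  exists2 C : R, 0 <= C & forall x, `|f x| <= C.
Proof.
move=> tf; have cf := test_function_continuous tf; case: tf => _ cS.
have : compact (f @` closure [set x | f x != 0]).
  by apply: continuous_compact => //; exact: continuous_subspaceT.
move=> /compact_bounded[M [_ MP]].
exists (Num.max 0 (M + 1)); first by rewrite le_max lexx.
move=> x; have [->|fx0] := eqVneq (f x) 0; first by rewrite normr0 le_max lexx.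
rewrite le_max; apply/orP; right; apply: MP; first by rewrite ltrDl.
by exists x => //; exact: subset_closure.
Qed.

Lemma test_function_lipschitz f : test_function f ->
  exists2 L : R, 0 <= L & forall x w, `|f (x + w) - f x| <= L * `|w|.
Proof.
move=> tf.
have : forall k : 'I_n, exists C : R, 0 <= C /\ forall x, `|pd k f x| <= C.
  move=> k; have [C C0 CP] := test_function_bounded (test_function_pd k tf).
  by exists C.
move=> /choice[C CP]; exists (\sum_k C k).
  by apply: sumr_ge0 => k _; have [] := CP k.
move=> x w; have [xi _ ->] := mean_value_rV (test_function_derivable tf) x w.
rewrite (le_trans (ler_norm_sum _ _ _))// mulr_suml; apply: ler_sum => k _.
by rewrite normrM mulrC ler_pM//; [exact: (CP k).2|exact: coord_norm_le].
Qed.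

(** Mean value formula with Lipschitz partial derivatives. The constant is uniform in [x], so the
    expansion can be integrated directly and differentiation under the integral needs no dominated
    convergence. *)
Lemma test_function_taylor f : test_function f ->
  exists2 C : R, 0 <= C & forall x w,
    `|f (x + w) - f x - \sum_(k < n) pd k f x * w 0 k| <= C * `|w| ^+ 2.
Proof.
move=> tf.
have : forall k : 'I_n, exists L : R, 0 <= L /\
    forall x w, `|pd k f (x + w) - pd k f x| <= L * `|w|.
  move=> k; have [L L0 LP] := test_function_lipschitz (test_function_pd k tf).
  by exists L.
move=> /choice[L LP]; exists (\sum_k L k).
  by apply: sumr_ge0 => k _; have [] := LP k.
move=> x w; have [xi xiP ->] := mean_value_rV (test_function_derivable tf) x w.
rewrite -sumrB (le_trans (ler_norm_sum _ _ _))// mulr_suml.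
apply: ler_sum => k _; rewrite [X in _ - X]mulrC -mulrBr normrM mulrC expr2 mulrA.
apply: ler_pM => //; last exact: coord_norm_le.
by rewrite (le_trans ((LP k).2 _ _))// ler_wpM2l//; exact: (LP k).1.
Qed.

End test_functions.

(** * The translation flow is a solution *)

Section probability_integrals.
Context d (T : measurableType d) (R : realType) (P : probability T R).

(** The bound is asked only on a set of full measure because velocities are bounded only almost
    surely. *)
Lemma as_bounded_integrable (f : T -> R) (C : R) (A : set T) :
  measurable A -> P A = 1%E -> measurable_fun [set: T] f ->
  (forall x, A x -> `|f x| <= C) -> P.-integrable [set: T] (EFin \o f).
Proof.
move=> mA PA mf fC.
apply/(negligible_integrable (N := ~` A)) => //; first exact: measurableC.
- exact/measurable_EFinP.
- exact: prob1_setC.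
rewrite setTD setCK; apply: measurable_bounded_integrable => //.
- by rewrite (le_lt_trans (probability_le1 _ mA))// ltry.
- exact: measurable_funTS.
- exists C; split; first exact: num_real.
  by move=> r Cr x Ax; rewrite /= (le_trans (fC _ Ax))// ltW.
Qed.

Lemma bounded_prob_integrable (f : T -> R) (C : R) :
  measurable_fun [set: T] f ->
  (forall x, `|f x| <= C) -> P.-integrable [set: T] (EFin \o f).
Proof.
move=> mf fC; apply: (@as_bounded_integrable f C setT) => //.
exact: probability_setT.
Qed.

Lemma Rintegral_sum (I : Type) (s : seq I) (f : I -> T -> R) :
  (forall i, P.-integrable [set: T] (EFin \o f i)) ->
  \int[P]_x (\sum_(i <- s) f i x) = \sum_(i <- s) \int[P]_x f i x.
Proof.
move=> intf; rewrite /Rintegral.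
under eq_integral => x _ do rewrite -sumEFin.
rewrite (@integral_sum _ _ _ P setT measurableT _ (fun i => EFin \o f i))//.
rewrite -sum_fine// => i _; exact: integrable_fin_num.
Qed.

Lemma as_le_normr_Rintegral (f : T -> R) (C : R) (A : set T) :
  measurable A -> P A = 1%E -> measurable_fun [set: T] f ->
  (forall x, A x -> `|f x| <= C) -> `|\int[P]_x f x| <= C.
Proof.
move=> mA PA mf fC; have intf := as_bounded_integrable mA PA mf fC.
have C0 : 0 <= C.
  have [A0|/set0P[x Ax]] := eqVneq A set0; last exact: le_trans (fC x Ax).
  by move/eqP: PA; rewrite A0 measure0 eq_sym onee_eq0.
rewrite -lee_fin (EFin_normr_Rintegral _ intf)//.
rewrite (le_trans (le_abse_integral _ _ _))//; first exact/measurable_EFinP.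
have -> : C%:E = (\int[P]_(x in setT) (cst C%:E x))%E.
  by rewrite integral_cst// [X in (_ * X)%E]probability_setT mule1.
apply: ae_ge0_le_integral => //.
- by apply: measurableT_comp => //; exact/measurable_EFinP.
- have [N [mN N0 AN]] := prob1_ae mA PA; exists N; split=> //.
  apply: subset_trans AN => x /= /not_implyP[_ fx] Ax; apply: fx.
  by rewrite lee_fin fC.
Qed.

Lemma le_normr_Rintegral_bound (f : T -> R) (C : R) :
  measurable_fun [set: T] f -> (forall x, `|f x| <= C) ->
  `|\int[P]_x f x| <= C.
Proof.
move=> mf fC; apply: (@as_le_normr_Rintegral f C setT) => //.
exact: probability_setT.
Qed.

End probability_integrals.

Lemma Rintegral_image_prob d d' (T : measurableType d) (T' : measurableType d')
    (R : realType) (P : probability T R) (f : T -> T')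
    (mf : measurable_fun [set: T] f) (g : T' -> R) :
  measurable_fun [set: T'] g -> P.-integrable [set: T] (EFin \o (g \o f)) ->
  \int[image_prob P mf]_y g y = \int[P]_x g (f x).
Proof.
move=> mg ig; rewrite /Rintegral; congr fine.
rewrite [LHS](integral_pushforward mf)//.
exact/measurable_EFinP.
Qed.

Lemma eq_meas_Rintegral d (T : measurableType d) (R : realType)
    (P Q : probability T R) (f : T -> R) :
  eq_meas P Q -> \int[P]_x f x = \int[Q]_x f x.
Proof.
move=> PQ; rewrite /Rintegral; congr fine.
by apply: eq_measure_integral => A mA _; exact: PQ.
Qed.

Lemma quadratic_is_derive (R : realType) (F : R -> R) (t l C : R) :
  (forall s, `|F (t + s) - F t - s * l| <= C * s ^+ 2) ->
  is_derive t (1 : R) F l.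
Proof.
move=> FC.
have lim : h^-1 *: ((F \o shift t) (h *: (1 : R)) - F t) @[h --> 0^'] --> l.
  have C0 : 0 <= C by have := FC 1; rewrite expr1n mulr1; exact: le_trans.
  apply/cvgrPdist_le => /= e e0; near=> h.
  have h0 : h != 0 by near: h; exact: nbhs_dnbhs_neq.
  have hC : `|h| <= e / (C + 1).
    near: h; apply: dnbhs0_le; rewrite divr_gt0// ltr_wpDl//.
  have -> : l - h^-1 *: (F (h *: (1 : R) + t) - F t) =
      - (h^-1 * (F (t + h) - F t - h * l)).
    by rewrite [h *: _]mulr1 [h + t]addrC /GRing.scale/=; field.
  rewrite normrN normrM normfV ler_pdivrMl ?normr_gt0//.
  rewrite (le_trans (FC h))// -normr_id -real_normK ?num_real// expr2 normr_id.
  rewrite mulrA mulrC ler_wpM2l// (le_trans (ler_wpM2l C0 hC))//.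
  rewrite mulrA ler_pdivrMr ?ltr_wpDl// mulrC ler_pM2l//.
  by rewrite lerDl.
apply: DeriveDef; first by apply/cvg_ex; exists l.
exact: cvg_lim.
Unshelve. all: by end_near. Qed.

Lemma lipschitz_abs_cont (R : realType) (a b L : R) (F : R -> R) : 0 <= L ->
  (forall s t, a <= s -> s <= t -> t <= b -> `|F t - F s| <= L * (t - s)) ->
  abs_cont a b F.
Proof.
move=> L0 FL e e0; exists (e / (L + 1)).
  by rewrite divr_gt0// ltr_wpDl.
move=> m J Jab _ Jd; apply: (@le_lt_trans _ _ (L * \sum_i ((J i).2 - (J i).1))).
  rewrite mulr_sumr; apply: ler_sum => i _.
  by have [? [? ?]] := Jab i; exact: FL.
move: Jd; rewrite ltr_pdivlMr ?ltr_wpDl//; apply: le_lt_trans.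
rewrite mulrC ler_wpM2l ?lerDl//.
by apply: sumr_ge0 => i _; have [_ [? _]] := Jab i; rewrite subr_ge0.
Qed.

Section translation.
Context (R : realType) (n : nat).

Lemma measurable_shift (w : 'rV[R]_n) :
  measurable_fun [set: Rn R n] (fun x : Rn R n => (x : 'rV[R]_n) + w : Rn R n).
Proof.
apply: measurable_fun_rV => k.
under eq_fun => x do rewrite mxE.
by apply: measurable_funD => //; exact: measurable_coord.
Qed.

Definition translate (mu : Pr R n) (w : 'rV[R]_n) : Pr R n :=
  image_prob mu (measurable_shift w).

End translation.

Section translation_solution.
Context (R : realType) (n : nat) (Vbar mu0 : Pr R n) (T M : R).
Hypothesis VbarM : Vbar [set v : 'rV[R]_n | `|v| < M] = 1%E.
Let w := mean Vbar.

Lemma integrable_coord k :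
  Vbar.-integrable setT (EFin \o (fun v : Rn R n => (v : 'rV[R]_n) 0 k)).
Proof.
apply: (as_bounded_integrable (C := M)) VbarM _ _ => /=.
- exact: measurable_norm_lt.
- exact: measurable_coord.
- by move=> v vM; rewrite (le_trans (coord_norm_le _ _))// ltW.
Qed.

Lemma measurable_grad_dot (f : 'rV[R]_n -> R) : test_function f ->
  measurable_fun setT (grad_dot f).
Proof.
move=> tf; apply: measurable_sum => k; apply: measurable_funM.
  apply: (measurableT_comp (f := (pd k f : Rn R n -> R))) => //.
  apply: continuous_measurable_rV.
  by apply: test_function_continuous; exact: test_function_pd.
by apply: (measurableT_comp (@measurable_coord R n k)).
Qed.

Lemma integrable_grad_dot (f : 'rV[R]_n -> R) (mu : Pr R n) :
  test_function f ->
  (prod_prob mu Vbar).-integrable setT (EFin \o grad_dot f).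
Proof.
move=> tf.
have : forall k : 'I_n, exists C : R, 0 <= C /\ forall x, `|pd k f x| <= C.
  move=> k; have [C C0 CP] := test_function_bounded (test_function_pd k tf).
  by exists C.
move=> /choice[C CP].
have mB : measurable ([set v : 'rV[R]_n | `|v| < M] : set (Rn R n)).
  exact: measurable_norm_lt.
apply: (@as_bounded_integrable _ (Rn R n * Rn R n)%type R (prod_prob mu Vbar)
  (grad_dot f) (\sum_k C k * M) (setT `*` [set v : 'rV[R]_n | `|v| < M])).
- exact: measurableX.
- rewrite [LHS]product_measure1E// [X in (X * _)%E]probability_setT mul1e.
  exact: VbarM.
- exact: measurable_grad_dot.
- move=> [x v] [_ /= vM]; rewrite (le_trans (ler_norm_sum _ _ _))//.
  apply: ler_sum => k _; rewrite normrM ler_pM//; first exact: (CP k).2.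
  by rewrite (le_trans (coord_norm_le _ _))// ltW.
Qed.

(** By Fubini the velocity is integrated first; the integrand is linear in it, so only the mean of
    [Vbar] survives. *)
Lemma Rintegral_grad_dot (f : 'rV[R]_n -> R) (mu : Pr R n) :
  test_function f ->
  \int[prod_prob mu Vbar]_p grad_dot f p =
  \int[mu]_x \sum_(k < n) pd k f x * w 0 k.
Proof.
move=> tf; rewrite /Rintegral; congr fine.
rewrite -[LHS](integral12_prod_meas1 (integrable_grad_dot mu tf)).
apply: eq_integral => x _; rewrite /fubini_F /=.
have iv k : Vbar.-integrable setT
    (EFin \o (fun v : Rn R n => pd k f x * (v : 'rV[R]_n) 0 k)).
  by have := integrableZl measurableT (pd k f x) (integrable_coord k).
transitivity ((\int[Vbar]_v grad_dot f (x, v))%:E)%R.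
  rewrite /Rintegral fineK//; apply: integrable_fin_num => //.
  rewrite (_ : (fun v => _) =
      (fun v => \sum_(k < n) (pd k f x * (v : 'rV[R]_n) 0 k)%:E)%E).
    by apply: integrable_sum => // k _; exact: iv.
  by apply/funext => v; rewrite /grad_dot/= sumEFin.
congr EFin; rewrite /grad_dot Rintegral_sum//.
apply: eq_bigr => k _; rewrite /= RintegralZl//; last exact: integrable_coord.
by rewrite /w mxE.
Qed.

Lemma translation_is_solution (mu : R -> Pr R n) : 0 < T ->
  (forall t, 0 <= t <= T -> eq_meas (mu t) (translate mu0 (t *: w))) ->
  is_solution (product_PVF Vbar) mu0 T mu.
Proof.
move=> T0 muE; split.
  move=> A mA; rewrite muE ?lexx ?ltW// scale0r.
  rewrite /translate; congr (mu0 _).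
  by apply/funext => x; rewrite /preimage/= addr0.
move=> f tf F G.
pose df (x : 'rV[R]_n) := \sum_(k < n) pd k f x * w 0 k.
have mtest g (u : 'rV[R]_n) : test_function g ->
    measurable_fun setT (fun x : Rn R n => g (x + u)).
  move=> tg; apply: (measurableT_comp (f := (g : Rn R n -> R))).
    by apply: continuous_measurable_rV; exact: test_function_continuous.
  exact: measurable_shift.
have itest g (nu : Pr R n) (u : 'rV[R]_n) : test_function g ->
    nu.-integrable setT (EFin \o (fun x : Rn R n => g (x + u))).
  move=> tg; have [C _ gC] := test_function_bounded tg.
  exact: (bounded_prob_integrable (C := C) _ (mtest g u tg)).
have FE t : 0 <= t <= T -> F t = \int[mu0]_x f (x + t *: w).
  move=> tT; rewrite /F (eq_meas_Rintegral _ (muE t tT)).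
  rewrite [LHS]Rintegral_image_prob//; last exact: itest.
  by have := mtest f 0 tf; under eq_fun do rewrite addr0.
have idf k u : mu0.-integrable setT
    (EFin \o (fun x : Rn R n => pd k f (x + u) * w 0 k)).
  have := integrableZr measurableT (w 0 k) (itest _ mu0 u (test_function_pd k tf)).
  by [].
have GE t : 0 <= t <= T -> G t = \int[mu0]_x df (x + t *: w).
  move=> tT; rewrite /G.
  rewrite (eq_meas_Rintegral _ (prod_prob_ext Vbar (muE t tT))) Rintegral_grad_dot//.
  rewrite [LHS]Rintegral_image_prob//.
  - apply: measurable_sum => k; apply: measurable_funM => //.
    have := mtest _ 0 (test_function_pd k tf).
    by under eq_fun do rewrite addr0.
  - rewrite (_ : EFin \o _ = (fun x : Rn R n =>
        \sum_(k < n) (pd k f ((x : 'rV[R]_n) + t *: w) * w 0 k)%:E)%E).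
      by apply: integrable_sum => // k _; exact: idf.
    by apply/funext => x; rewrite /= sumEFin.
(* [mu] is known only on [[0, T]]; [Fh] and [Gh] extend [F] and [G] by the flow to all times, so
   that two-sided estimates make sense. *)
pose Fh (t : R) := \int[mu0]_x f (x + t *: w).
pose Gh (t : R) := \int[mu0]_x df (x + t *: w).
have idfu u : mu0.-integrable setT (EFin \o (fun x : Rn R n => df (x + u))).
  rewrite (_ : EFin \o _ = (fun x : Rn R n =>
      \sum_(k < n) (pd k f ((x : 'rV[R]_n) + u) * w 0 k)%:E)%E).
    by apply: integrable_sum => // k _; exact: idf.
  by apply/funext => x; rewrite /= sumEFin.
have ifu u := itest f mu0 u tf.
(* Used twice: for [f] it gives absolute continuity of [F], for [df] the continuity of [Gh] and thus
   its integrability on [[0, T]]. *)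
have lip (g : 'rV[R]_n -> R) (L : R) : 0 <= L ->
    (forall u, mu0.-integrable setT (EFin \o (fun x : Rn R n => g (x + u)))) ->
    (forall x u, `|g (x + u) - g x| <= L * `|u|) ->
    forall s t, `|\int[mu0]_x g (x + t *: w) - \int[mu0]_x g (x + s *: w)| <=
      L * `|w| * `|t - s|.
  move=> L0 ig gL s t; rewrite -RintegralB//.
  have mg u : measurable_fun setT (fun x : Rn R n => g (x + u)).
    by have /integrableP[/measurable_EFinP] := ig u.
  apply: le_normr_Rintegral_bound; first exact: measurable_funB.
  move=> x; have -> : (x : 'rV[R]_n) + t *: w = x + s *: w + (t - s) *: w.
    by rewrite -addrA -scalerDl subrKC.
  by rewrite (le_trans (gL _ _))// normrZ mulrCA mulrC.
have [L L0 fL] := test_function_lipschitz tf.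
have [L' L'0 dfL] : exists2 L' : R, 0 <= L' &
    forall x u, `|df (x + u) - df x| <= L' * `|u|.
  have : forall k : 'I_n, exists C : R, 0 <= C /\
      forall x u, `|pd k f (x + u) - pd k f x| <= C * `|u|.
    move=> k; have [C C0 CP] := test_function_lipschitz (test_function_pd k tf).
    by exists C.
  move=> /choice[C CP]; exists (\sum_k C k * `|w 0 k|).
    by apply: sumr_ge0 => k _; rewrite mulr_ge0//; have [] := CP k.
  move=> x u; rewrite /df -sumrB (le_trans (ler_norm_sum _ _ _))// mulr_suml.
  apply: ler_sum => k _; rewrite -mulrBl normrM mulrAC ler_wpM2r//.
  exact: (CP k).2.
have [C C0 fC] := test_function_taylor tf.
have FhC (t s : R) : `|Fh (t + s) - Fh t - s * Gh t| <= C * `|w| ^+ 2 * s ^+ 2.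
  rewrite /Fh /Gh -RintegralB// -RintegralZl// -RintegralB//; last 2 first.
  - by have := integrableB measurableT (ifu ((t + s) *: w)) (ifu (t *: w)).
  - by have := integrableZl measurableT s (idfu (t *: w)).
  apply: le_normr_Rintegral_bound.
    apply: measurable_funB; first apply: measurable_funB.
    - exact: mtest.
    - exact: mtest.
    - apply: measurable_funM => //.
      by have /integrableP[/measurable_EFinP] := idfu (t *: w).
  move=> x; rewrite scalerDl addrA.
  have := fC ((x : 'rV[R]_n) + t *: w) (s *: w).
  rewrite normrZ exprMn real_normK ?num_real// mulrA mulrAC.
  congr (`| _ - _ | <= _); rewrite /df mulr_sumr; apply: eq_bigr => k _.
  by rewrite mxE mulrCA.
split.
- by apply: aeW => s _; exact: integrable_grad_dot.
- exists Gh; last by apply: aeW => s; rewrite in_itv/= => sT; exact: GE.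
  apply: continuous_compact_integrable; first exact: segment_compact.
  apply: continuous_subspaceT => t; apply/cvgrPdist_le => /= e e0; near=> s.
  rewrite distrC (le_trans (lip df L' L'0 idfu dfL t s))//.
  rewrite (@le_trans _ _ ((L' * `|w| + 1) * `|s - t|))//.
    by rewrite ler_wpM2r// lerDl.
  rewrite mulrC -ler_pdivlMr ?ltr_wpDl ?mulr_ge0// distrC; near: s.
  by apply: cvgr_dist_le; [exact: cvg_id|rewrite divr_gt0 ?ltr_wpDl ?mulr_ge0].
- apply: (@lipschitz_abs_cont _ _ _ (L * `|w|)); first by rewrite mulr_ge0.
  move=> s t s0 st tT; rewrite !FE ?s0 ?tT ?(le_trans st tT) ?(le_trans s0 st)//.
  by rewrite -[X in _ * X]ger0_norm ?subr_ge0//; exact: lip.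
(* Outside [[0, T]] the curve is arbitrary, so the two-sided derivative of [F] may fail to exist at
   the endpoints. *)
- exists ([set 0] `|` [set T]); split.
  + by apply: measurableU.
  + by rewrite measureU0//; exact: lebesgue_measure_set1.
  + move=> t /= /not_implyP[]; rewrite in_itv/= => /andP[t0 tT] nd.
    apply: contrapT => /not_orP[/eqP tn0 /eqP tnT]; apply: nd.
    have tgt0 : 0 < t by rewrite lt_neqAle eq_sym tn0.
    have tltT : t < T by rewrite lt_neqAle tnT.
    rewrite GE ?t0//; apply: near_eq_is_derive (quadratic_is_derive (FhC t)).
    near=> s; rewrite /= FE//; apply/andP; split; apply: ltW; near: s.
      exact: lt_nbhsr.
    exact: lt_nbhsl.
Unshelve. all: by end_near. Qed.
End translation_solution.

(** * Uniqueness of Wasserstein limits *)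

Section W1_uniqueness.
Context (R : realType) (n : nat).

Lemma measurable_enormB d (T : measurableType d) (f g : T -> Rn R n) :
  measurable_fun [set: T] f -> measurable_fun [set: T] g ->
  measurable_fun [set: T]
    (fun t => enorm ((f t : 'rV[R]_n) - (g t : 'rV[R]_n))).
Proof.
move=> mf mg; rewrite /enorm.
apply: (measurableT_comp (f := @Num.sqrt R)).
  by apply: continuous_measurable_fun; exact: sqrt_continuous.
apply: measurable_sum => k.
under eq_fun => t do rewrite !mxE.
apply: measurable_funX; apply: measurable_funB.
  exact: (measurableT_comp (@measurable_coord R n k)).
exact: (measurableT_comp (@measurable_coord R n k)).
Qed.

Lemma norm_le_enorm (x : 'rV[R]_n) : `|x| <= enorm x.
Proof.
apply: rV_norm_le => [|k]; first exact: sqrtr_ge0.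
rewrite -sqrtr_sqr ler_sqrt; last by apply: sumr_ge0 => j _; exact: sqr_ge0.
rewrite (bigD1 k)//= lerDl; apply: sumr_ge0 => j _; exact: sqr_ge0.
Qed.

Lemma enormN (x : 'rV[R]_n) : enorm (- x) = enorm x.
Proof. by rewrite /enorm; under eq_bigr => k _ do rewrite mxE sqrrN. Qed.

(** Markov's inequality: [f] and [g] are at distance at least [delta] with probability at most [e];
    elsewhere [f t] in [A] forces [g t] in [B]. The sup norm in the hypothesis is dominated by the
    Euclidean cost. *)
Lemma coupling_markov d (T : measurableType d) (P : probability T R)
    (f g : T -> Rn R n) (A B : set (Rn R n)) (delta e : R) :
  measurable_fun [set: T] f -> measurable_fun [set: T] g ->
  measurable A -> measurable B -> 0 < delta -> 0 <= e ->
  (forall x y : 'rV[R]_n, A x -> `|x - y| < delta -> B y) ->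
  (\int[P]_t (enorm ((f t : 'rV[R]_n) - (g t : 'rV[R]_n)))%:E
    <= (delta * e)%:E)%E ->
  (P (f @^-1` A) <= P (g @^-1` B) + e%:E)%E.
Proof.
move=> mf mg mA mB d0 e0 AB ife.
pose h t := enorm ((f t : 'rV[R]_n) - (g t : 'rV[R]_n)).
have mh : measurable_fun setT h by exact: measurable_enormB.
pose D := [set: T] `&` [set t | (delta%:E <= `|(h t)%:E|)%E].
have mD : measurable D.
  apply: emeasurable_fun_c_infty => //.
  by apply: measurableT_comp => //; exact/measurable_EFinP.
have mfA : measurable (f @^-1` A) by rewrite -[X in measurable X]setTI; exact: mf.
have mgB : measurable (g @^-1` B) by rewrite -[X in measurable X]setTI; exact: mg.
apply: (@le_trans _ _ (P (g @^-1` B `|` D))%E).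
  apply: le_measure; rewrite ?inE//; first exact: measurableU.
  move=> t At; have [dh|hd] := leP delta (h t).
    by right; split=> //=; rewrite lee_fin ger0_norm// sqrtr_ge0.
  by left; apply: (AB _ _ At); rewrite (le_lt_trans (norm_le_enorm _)).
rewrite (le_trans (measureU2 _ _ _))// leeD2l//.
rewrite -(@lee_pmul2l _ delta%:E)// -EFinM.
rewrite (le_trans (@le_integral_abse _ _ R P setT measurableT (EFin \o h) delta _ d0))//.
  exact/measurable_EFinP.
rewrite (le_trans _ ife)// le_eqVlt; apply/orP; left; apply/eqP.
apply: eq_integral => t _; rewrite /= ger0_norm//; exact: sqrtr_ge0.
Qed.

Lemma W1_le_prob (mu nu : Pr R n) (A B : set (Rn R n)) (delta e : R) :
  measurable A -> measurable B -> 0 < delta -> 0 < e ->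
  (forall x y : 'rV[R]_n, A x -> `|x - y| < delta -> B y) ->
  (W1 mu nu <= (delta * e / 2)%:E)%E ->
  (mu A <= nu B + e%:E)%E /\ (nu A <= mu B + e%:E)%E.
Proof.
move=> mA mB d0 e0 AB Wde.
(* The infimum need not be attained; the factor 1/2 in the hypothesis makes room for a strict
   inequality, hence for an actual coupling of cost below [delta * e]. *)
have : (W1 mu nu < (delta * e)%:E)%E.
  by rewrite (le_lt_trans Wde)// lte_fin ltr_pdivrMr// ltr_pMr ?mulr_gt0// ltr1n.
move=> /ereal_inf_lt[_ [g [g1 g2] <-] gde].
rewrite -!(g1 _ mA) -!(g1 _ mB) -!(g2 _ mA) -!(g2 _ mB); split.
  apply: (coupling_markov (P := g) (delta := delta)) => //.
  - exact: ltW.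
  - exact: ltW.
apply: (coupling_markov (P := g) (delta := delta)) => //; [exact: ltW|].
under eq_integral => p _ do rewrite -opprB enormN.
exact: ltW.
Qed.

(** No triangle inequality for [W1], hence no gluing of couplings, is used. Both measures are
    compared with [rho] on open sets, a pi-system generating the Borel sets. An open [U] is
    exhausted by the points at distance at least [delta] from its complement; these sets are closed,
    their complements being unions of balls. *)
Lemma W1_limit_unique (mu nu : Pr R n) :
  (forall eps : R, 0 < eps -> exists rho : Pr R n,
    (W1 rho mu <= eps%:E)%E /\ (W1 rho nu <= eps%:E)%E) ->
  eq_meas mu nu.
Proof.
pose shrink (U : set 'rV[R]_n) (delta : R) :=
  [set x : 'rV[R]_n | forall y, `|x - y| < delta -> U y].
have mshrink U delta : measurable (shrink U delta : set (Rn R n)).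
  apply: closed_measurable_rV.
  have -> : shrink U delta = ~` \bigcup_(y in ~` U) ball y delta.
    apply/seteqP; split=> [x xU [y /= nUy]|x xU y xy].
      by rewrite -ball_normE/= distrC => /xU.
    apply: contrapT => nUy; apply: xU; exists y => //.
    by rewrite -ball_normE/= distrC.
  apply: open_closedC; apply: bigcup_open => y _.
  exact: ball_open.
suff key (mu' nu' : Pr R n) :
    (forall eps : R, 0 < eps -> exists rho : Pr R n,
      (W1 rho mu' <= eps%:E)%E /\ (W1 rho nu' <= eps%:E)%E) ->
    forall U, open U -> (mu' U <= nu' U)%E.
  move=> close; apply: (@measure_unique _ R (Rn R n) (@open 'rV[R]_n) (fun=> setT)).
  - by [].
  - by move=> U W; exact: openI.
  - by move=> _; exact: openT.
  - by rewrite bigcup_const//; exists 0%N.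
  - move=> U oU; apply/eqP; rewrite eq_le !key// => eps /close[rho [? ?]].
    by exists rho.
  - by move=> _; rewrite (le_lt_trans (probability_le1 _ _))// ltry.
move=> close U oU.
pose U_ m := shrink U m.+1%:R^-1.
have UE : \bigcup_m U_ m = U.
  apply/seteqP; split=> [x [m _]|x Ux].
    by move=> /(_ x); rewrite subrr normr0 invr_gt0 ltr0n; exact.
  have /nbhs_ballP[e /= e0 eU] : nbhs x U by exact: open_nbhs_nbhs.
  have [m _ me] := near_infty_natSinv_lt (PosNum e0).
  exists m => // y xy; apply: eU; rewrite -ball_normE/=.
  by rewrite (lt_trans xy)//; exact: me m (leqnn m).
have ndU : {homo U_ : m k / (m <= k)%N >-> (m <= k)%O}.
  move=> m k mk; apply/subsetPset => x Ux y xy; apply: Ux.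
  by rewrite (lt_le_trans xy)// lef_pV2 ?posrE ?ltr0n// ler_nat.
have mU := open_measurable_rV oU.
have := @nondecreasing_cvg_mu _ _ _ mu' U_ (fun m => mshrink U _).
rewrite UE => /(_ mU ndU) cvgU.
rewrite -(cvg_lim _ cvgU)//; apply: lime_le; first by apply/cvg_ex; eexists; exact: cvgU.
near=> m; apply/lee_addgt0Pr => e e0.
(* Half of the margin is spent in passing from [mu'] to [rho], the other half from [rho] to [nu'];
   the error [e] is split in the same way. *)
pose delta : R := m.+1%:R^-1 / 2.
have d0 : 0 < delta by rewrite divr_gt0.
have e20 : 0 < e / 2 by rewrite divr_gt0.
have [|rho [Wmu Wnu]] := close (delta * (e / 2) / 2).
  by rewrite divr_gt0// mulr_gt0.
have shrink_half (x y : 'rV[R]_n) :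
    U_ m x -> `|x - y| < delta -> shrink U delta y.
  move=> xU xy z yz; apply: xU.
  by rewrite -(subrKA y) (le_lt_trans (ler_normD _ _))// [ltRHS]splitr ltrD.
have [_ H1] := W1_le_prob (mshrink U m.+1%:R^-1) (mshrink U delta) d0 e20
  shrink_half Wmu.
have [H2 _] := W1_le_prob (mshrink U delta) mU d0 e20
  (fun x y xU xy => xU y xy) Wnu.
by rewrite (le_trans H1)// (le_trans (leeD2r _ H2))// -addeA -EFinD -splitr.
Unshelve. all: by end_near. Qed.
End W1_uniqueness.

(** * Quantization on a lattice *)

Section quantization.
Context (R : realType) (n : nat).

(** Rounding down to the full lattice of mesh [1/m]: it sends a half-open [cell] to its corner
    [lattice_pt], but involves no truncation to a box. *)
Definition quant (m : nat) (x : 'rV[R]_n) : 'rV[R]_n :=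
  \row_k ((Num.floor (x 0 k * m%:R))%:~R / m%:R).

Lemma measurable_quant m :
  measurable_fun [set: Rn R n] (fun x : Rn R n => quant m x : Rn R n).
Proof.
apply: measurable_fun_rV => k; rewrite /quant.
under eq_fun => x do rewrite mxE.
apply: measurable_funM => //.
apply: (measurableT_comp (f := fun r : R => (Num.floor r)%:~R : R)).
  exact: measurable_floor.
by apply: measurable_funM => //; exact: measurable_coord.
Qed.

Lemma quant_close m (x : 'rV[R]_n) k : (0 < m)%N ->
  `|quant m x 0 k - x 0 k| <= m%:R^-1.
Proof.
move=> m0; have m0' : 0 < m%:R :> R by rewrite ltr0n.
rewrite mxE distrC ler_distlC.
have := floor_le (x 0 k * m%:R); have := ltW (floorD1_gt (x 0 k * m%:R)).
set z := Num.floor _; rewrite intrD => H1 H2.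
apply/andP; split.
  by rewrite lerBlDr -[X in _ + X]mul1r -mulrDl ler_pdivlMr.
rewrite -lerBlDr; apply: le_trans (_ : z%:~R / m%:R <= _).
  by rewrite lerBlDr lerDl invr_ge0 ltW.
by rewrite ler_pdivrMr.
Qed.

Lemma quant_norm_le m (x : 'rV[R]_n) : (0 < m)%N -> `|quant m x| <= `|x| + m%:R^-1.
Proof.
move=> m0; rewrite -[quant m x](subrK x) addrC.
rewrite (le_trans (ler_normD _ _))// lerD2l.
apply: rV_norm_le => // k; rewrite mxE [X in _ + X]mxE; exact: quant_close.
Qed.

Lemma quant_id m (z : 'I_n -> int) (x : 'rV[R]_n) : (0 < m)%N ->
  (forall k, x 0 k = (z k)%:~R / m%:R) -> quant m x = x.
Proof.
move=> m0 xz; apply/rowP => k; rewrite mxE xz divfK ?intrKfloor//.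
by rewrite pnatr_eq0 -lt0n.
Qed.

Lemma quant_fixed m (x : 'rV[R]_n) : quant m x = x ->
  forall k, x 0 k = (Num.floor (x 0 k * m%:R))%:~R / m%:R.
Proof. by move=> xq k; rewrite -{1}xq mxE. Qed.

Lemma quant_quant m (x : 'rV[R]_n) : (0 < m)%N -> quant m (quant m x) = quant m x.
Proof.
move=> m0; apply: (@quant_id _ (fun k => Num.floor (x 0 k * m%:R))) => // k.
by rewrite mxE.
Qed.

Lemma cell_quant N m (i : lattice n N m) (x : 'rV[R]_n) : (0 < m)%N ->
  cell m%:R^-1 (lattice_pt R i) x -> quant m x = lattice_pt R i.
Proof.
move=> m0 xi; have m0' : 0 < m%:R :> R by rewrite ltr0n.
apply/rowP => k; rewrite !mxE; congr (_ / _).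
have /andP[] := xi k; rewrite !mxE -[X in _ / _ + X]mul1r -mulrDl.
rewrite ler_pdivrMr// ltr_pdivlMr// => H1 H2.
have -> : (i k)%:R - (N * m)%:R = ((i k)%:Z - (N * m)%:Z)%:~R :> R.
  by rewrite intrB.
by congr (_%:~R); apply: floor_def; rewrite !intrD intrN; apply/andP; split.
Qed.

Lemma lattice_cell N m (x : 'rV[R]_n) : (0 < m)%N -> `|x| <= N%:R ->
  exists i : lattice n N m, cell m%:R^-1 (lattice_pt R i) x.
Proof.
move=> m0 xN; have m0' : 0 < m%:R :> R by rewrite ltr0n.
(* The shift makes indices start at 0. The extreme value [x 0 k = N] gets the last index
   [2 * (N * m)], which the lattice includes. *)
pose z k : int := Num.floor (x 0 k * m%:R) + (N * m)%:Z.
have xk k : - N%:R <= x 0 k <= N%:R.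
  by rewrite -ler_norml (le_trans (coord_norm_le _ _)).
have z0 k : 0 <= z k.
  rewrite /z -lerBlDr sub0r floor_ge_int intrN.
  by rewrite (_ : _%:~R = (N * m)%:R)// natrM -mulNr ler_pM2r//; have /andP[] := xk k.
have zN k : (`|z k| < (2 * (N * m)).+1)%N.
  rewrite ltnS -lez_nat gez0_abs// /z mul2n -addnn PoszD lerD2r.
  rewrite -(ler_int R) (le_trans (floor_le _))//.
  rewrite (_ : _%:~R = (N * m)%:R)// natrM ler_pM2r//.
  by have /andP[] := xk k.
exists [ffun k => Ordinal (zN k)] => k; rewrite !mxE ffunE /=.
have -> : `|z k|%:R - (N * m)%:R = (Num.floor (x 0 k * m%:R))%:~R :> R.
  by rewrite natr_absz ger0_norm// intrD addrK.
rewrite -[X in _ / _ + X]mul1r -mulrDl ler_pdivrMr// ltr_pdivlMr//.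
by rewrite floor_le /= -[1]/(1%:~R) -intrD floorD1_gt.
Qed.

Lemma lattice_pt_inj N m : (0 < m)%N -> injective (@lattice_pt R n N m).
Proof.
move=> m0 i j /rowP ij; apply/ffunP => k; apply/val_inj/eqP.
have := ij k; rewrite !mxE => /(mulIf _); rewrite invr_eq0 pnatr_eq0 -lt0n.
by move=> /(_ m0) /addIr /eqP; rewrite eqr_nat.
Qed.

Lemma cell_disjoint N m (i j : lattice n N m) (x : 'rV[R]_n) : (0 < m)%N ->
  cell m%:R^-1 (lattice_pt R i) x -> cell m%:R^-1 (lattice_pt R j) x -> i = j.
Proof.
by move=> m0 /(cell_quant m0) xi /(cell_quant m0) xj;
  apply: (lattice_pt_inj m0); rewrite -xi.
Qed.

End quantization.

(** A variable that is constant on each piece of a finite partition, up to a null set, has a law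
    that is a finite sum of Dirac masses. Both [LAS_init] and [LAS_step] are recognized as laws of
    this kind. *)
Lemma discrete_law d d' (T : measurableType d) (T' : measurableType d')
    (R : realType) (P : probability T R) (I : finType) (E : I -> set T)
    (X : T -> T') (c : I -> T') (A : set T') :
  (forall i, measurable (E i)) -> trivIset setT E ->
  P (\bigcup_i E i) = 1%E -> measurable_fun setT X ->
  (forall i t, E i t -> X t = c i) -> measurable A ->
  P (X @^-1` A) = (\sum_i P (E i) * \d_(c i) A)%E.
Proof.
move=> mE tE PE mX XE mA.
have mXA : measurable (X @^-1` A) by rewrite -[X in measurable X]setTI; exact: mX.
have mU : measurable (\bigcup_i E i) by apply: fin_bigcup_measurable.
have -> : P (X @^-1` A) = P (\bigcup_i (X @^-1` A `&` E i)).
  rewrite -setI_bigcupr; apply/eqP; rewrite eq_le; apply/andP; split; last first.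
    by apply: le_measure; rewrite ?inE//; exact: measurableI.
  rewrite -[leRHS]adde0 -(prob1_setC mU PE).
  apply: le_trans (measureU2 _ _ _); last 2 first.
  - exact: measurableI.
  - exact: measurableC.
  apply: le_measure; rewrite ?inE//.
    by apply: measurableU; [exact: measurableI|exact: measurableC].
  by move=> t At; have [Et|nEt] := EM ((\bigcup_i E i) t); [left|right].
rewrite measure_fin_bigcup//; last 3 first.
- exact: finite_finset.
- exact: trivIset_setIl.
- by move=> i _; exact: measurableI.
have -> : [set: I] = [set i | i \in index_enum I].
  by apply/seteqP; split=> i //= _; rewrite mem_index_enum.
rewrite -fsbig_seq ?index_enum_uniq//; apply: eq_bigr => i _.
rewrite diracE; have [/set_mem Ac|/negP nAc] := boolP (c i \in A).
  rewrite mule1; congr (P _); apply/seteqP; split=> [t []//|t Et].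
  by split=> //; rewrite /preimage/= (XE _ _ Et).
rewrite mule0 (_ : _ `&` _ = set0) ?measure0//.
apply/seteqP; split=> // t [/= At Et]; apply: nAc.
by rewrite inE -(XE _ _ Et).
Qed.

(** * Coupling the lattice scheme with the translation flow *)

(** Expansion of the square: [eta] bounds the bias and controls the cross term, [C] controls the
    quadratic term. *)
Lemma noise_second_moment d (T : measurableType d) (R : realType)
    (P : probability T R) (e : T -> R) (A : set T) (C eta t a : R) :
  measurable A -> P A = 1%E -> measurable_fun [set: T] e ->
  (forall x, A x -> `|e x| <= C) -> `|\int[P]_x e x| <= eta -> 0 <= t ->
  (\int[P]_x ((a + t * e x) ^+ 2)%:E <=
    ((1 + t * eta) * a ^+ 2 + (t * eta + t ^+ 2 * C ^+ 2))%:E)%E.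
Proof.
move=> mA PA me eC eeta t0; have inte := as_bounded_integrable mA PA me eC.
have me2 : measurable_fun [set: T] (fun x => e x ^+ 2) by exact: measurable_funX.
have e2C x : A x -> `|e x ^+ 2| <= C ^+ 2.
  by move=> Ax; rewrite normrX lerXn2r ?nnegrE ?normr_ge0 ?eC// (le_trans _ (eC _ Ax)).
have inte2 := as_bounded_integrable mA PA me2 e2C.
have := as_le_normr_Rintegral mA PA me2 e2C.
set e1 := \int[P]_x e x in eeta *; set e2 := \int[P]_x _ => e2le.
have -> : (\int[P]_x ((a + t * e x) ^+ 2)%:E)%E =
    (a ^+ 2 + (2 * t * a) * e1 + t ^+ 2 * e2)%:E.
  have i1 : P.-integrable setT (EFin \o (fun x => (2 * t * a) * e x)).
    by have := integrableZl measurableT (2 * t * a) inte.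
  have i2 : P.-integrable setT (EFin \o (fun x => t ^+ 2 * e x ^+ 2)).
    by have := integrableZl measurableT (t ^+ 2) inte2.
  have i0 : P.-integrable setT (EFin \o cst (a ^+ 2)).
    exact: finite_measure_integrable_cst.
  have i01 : P.-integrable setT (EFin \o (fun x => a ^+ 2 + (2 * t * a) * e x)).
    by have := integrableD measurableT i0 i1.
  have i012 : P.-integrable setT
      (EFin \o (fun x => a ^+ 2 + (2 * t * a) * e x + t ^+ 2 * e x ^+ 2)).
    by have := integrableD measurableT i01 i2.
  transitivity ((\int[P]_x (a ^+ 2 + (2 * t * a) * e x + t ^+ 2 * e x ^+ 2))%:E).
    rewrite /Rintegral fineK; last exact: integrable_fin_num.
    by apply: eq_integral => x _; congr EFin; ring.
  congr EFin; rewrite RintegralD// RintegralD// RintegralZl// RintegralZl//.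
  by rewrite Rintegral_cst// [X in fine X]probability_setT mulr1.
rewrite lee_fin.
(* [2 * |a| <= 1 + a ^+ 2] turns the cross term into a multiple of [a ^+ 2] plus a constant. *)
have H1 : 2 * a * e1 <= eta * (1 + a ^+ 2).
  have eta0 : 0 <= eta by exact: le_trans eeta.
  rewrite (le_trans (ler_norm _))// !normrM ger0_norm//.
  apply: (@le_trans _ _ (2 * `|a| * eta)).
    by rewrite ler_wpM2l// mulr_ge0.
  rewrite mulrC ler_wpM2l// -[a ^+ 2]real_normK ?num_real//.
  by have := sqr_ge0 (`|a| - 1); nra.
have H2 := ler_wpM2l t0 H1.
have H3 : t ^+ 2 * e2 <= t ^+ 2 * C ^+ 2.
  by rewrite ler_wpM2l ?sqr_ge0// (le_trans (ler_norm _)).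
by nra.
Qed.

Section coupling.
Context (R : realType) (n : nat) (Vbar mu0 : Pr R n).
Let w := mean Vbar.

(** The third component of [p] is the sampled velocity: it moves only the scheme, after rounding,
    whereas the flow moves deterministically. *)
Definition couple_map (N : nat) (t : R) (p : Rn R n * Rn R n * Rn R n) :
    Rn R n * Rn R n :=
  ((p.1.1 : 'rV[R]_n) + t *: quant N p.2, (p.1.2 : 'rV[R]_n) + t *: w).

Lemma measurable_couple_map N t : measurable_fun setT (couple_map N t).
Proof.
apply: measurable_fun_pair; apply: measurable_fun_rV => k.
  under eq_fun => p do rewrite mxE [X in _ + X]mxE.
  apply: measurable_funD.
    apply: (measurableT_comp (@measurable_coord R n k)).
    exact: measurableT_comp.
  apply: measurable_funM => //.
  apply: (measurableT_comp (@measurable_coord R n k)).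
  by apply: (measurableT_comp (@measurable_quant R n N)).
under eq_fun => p do rewrite mxE.
apply: measurable_funD => //.
apply: (measurableT_comp (@measurable_coord R n k)).
exact: measurableT_comp.
Qed.

Definition noisy (g : PrT R n) :
    probability (Rn R n * Rn R n * Rn R n)%type R := (g \x Vbar)%E.

Definition couple_step (N : nat) (t : R) (g : PrT R n) : PrT R n :=
  image_prob (noisy g) (measurable_couple_map N t).

Definition couple_start (N : nat) (x : Rn R n) : Rn R n * Rn R n :=
  (quant (N ^ 2) x, x).

Lemma measurable_couple_start N : measurable_fun setT (couple_start N).
Proof.
by apply: measurable_fun_pair; [exact: measurable_quant|exact: measurable_id].
Qed.

(* Joint law at time [l / N] of the lattice scheme ([fst]) and of the translation
   flow ([snd]). *)
Fixpoint couple (N l : nat) : PrT R n :=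
  if l is l'.+1 then couple_step N N%:R^-1 (couple N l')
  else image_prob mu0 (measurable_couple_start N).

Lemma noisyX (g : PrT R n) A B : measurable A -> measurable B ->
  noisy g (A `*` B) = (g A * Vbar B)%E.
Proof. by move=> mA mB; rewrite [LHS]product_measure1E. Qed.

Lemma noisyXT (g : PrT R n) A : measurable A -> noisy g (fst @^-1` A) = g A.
Proof.
move=> mA; rewrite -[RHS]mule1 -(probability_setT Vbar) -noisyX//.
by congr (noisy g _); apply/seteqP; split=> [p|p []].
Qed.

Lemma couple_step_snd N t g A : measurable A ->
  couple_step N t g (snd @^-1` A) =
  g (snd @^-1` ((fun x : 'rV[R]_n => x + t *: w) @^-1` A)).
Proof.
move=> mA; rewrite -[RHS]noisyXT//.
have mB := measurable_preimage (measurable_shift (t *: w)) mA.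
exact: (measurable_snd_preimage mB).
Qed.

Lemma couple_snd N l : (0 < N)%N ->
  eq_meas (pushforward (couple N l) snd) (translate mu0 ((l%:R / N%:R) *: w)).
Proof.
move=> N0; elim: l => [|l IH] A mA.
  rewrite /pushforward/= mul0r scale0r /translate; congr (mu0 _).
  by apply/funext => x; rewrite /preimage/= addr0.
rewrite /pushforward [LHS]couple_step_snd//.
have := IH ((fun x : Rn R n => (x : 'rV[R]_n) + N%:R^-1 *: w) @^-1` A).
rewrite /pushforward => ->; last exact: (measurable_preimage (measurable_shift _)).
rewrite /translate; congr (mu0 _); apply/funext => x; rewrite /preimage/=.
by rewrite -addrA -scalerDl -[X in _ / _ + X]mul1r -mulrDl -natr1.
Qed.

Lemma couple_step_couple_snd N t l : (0 < N)%N ->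
  eq_meas (pushforward (couple_step N t (couple N l)) snd)
          (translate mu0 ((l%:R / N%:R + t) *: w)).
Proof.
move=> N0 A mA; rewrite /pushforward [LHS]couple_step_snd//.
have := couple_snd l N0.
move=> /(_ ((fun x : Rn R n => (x : 'rV[R]_n) + t *: w) @^-1` A)).
rewrite /pushforward => ->; last exact: (measurable_preimage (measurable_shift _)).
rewrite /translate; congr (mu0 _); apply/funext => x; rewrite /preimage/=.
by rewrite -addrA -scalerDl.
Qed.

Lemma couple_step0 N (g : PrT R n) A : measurable A -> couple_step N 0 g A = g A.
Proof.
move=> mA; rewrite -[RHS]noisyXT//.
rewrite -[LHS]/(noisy g (couple_map N 0 @^-1` A)); congr (noisy g _).
apply/funext => -[[x y] v].
by rewrite /preimage/couple_map/= !scale0r !addr0.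
Qed.

End coupling.

(** * The lattice approximate solutions *)

Section lattice_curve.
Context (R : realType) (n : nat) (Vbar mu0 : Pr R n) (M r : R).
Hypothesis VbarM : Vbar [set v : 'rV[R]_n | `|v| < M] = 1%E.
Hypothesis mu0r : mu0 [set x : 'rV[R]_n | `|x| < r] = 1%E.

Definition grid (N : nat) (b : R) : set (Rn R n) :=
  [set x : 'rV[R]_n | quant (N ^ 2) x = x /\ `|x| < b].

Lemma measurable_grid N b : measurable (grid N b).
Proof.
apply: (@measurableI _ (Rn R n) [set x : 'rV[R]_n | quant (N ^ 2) x = x]);
  last exact: measurable_norm_lt.
have -> : [set x : 'rV[R]_n | quant (N ^ 2) x = x] =
    \bigcap_(k in [set: 'I_n])
      (fun x : 'rV[R]_n => quant (N ^ 2) x 0 k - x 0 k) @^-1` [set 0].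
  apply/seteqP; split=> [x xq k _|x xq]; first by rewrite /= xq subrr.
  by apply/rowP => k; have /= /eqP := xq k I; rewrite subr_eq0 => /eqP.
apply: fin_bigcap_measurable => // k _; apply: measurable_preimage => //.
apply: measurable_funB; last exact: measurable_coord.
apply: (measurableT_comp (@measurable_coord R n k)).
exact: measurable_quant.
Qed.

(** Rounding moves the start by at most 1 and makes speeds at most [M + 1], so each step enlarges
    the radius by at most [(M + 1) / N]. *)
Lemma couple_grid N l : (0 < N)%N ->
  couple Vbar mu0 N l (fst @^-1` grid N (r + 1 + l%:R / N%:R * (M + 1))) = 1%E.
Proof.
move=> N0; have N20 : (0 < N ^ 2)%N by rewrite expn_gt0 N0.
have mg b : measurable (fst @^-1` grid N b : set (Rn R n * Rn R n)).
  exact: (measurable_fst_preimage (measurable_grid N b)).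
have N1 (m : nat) : (0 < m)%N -> m%:R^-1 <= 1 :> R.
  by move=> m0; rewrite invf_le1 ?ltr0n// ler1n.
elim: l => [|l IH].
  apply: prob1_subset mu0r => /=.
  - exact: measurable_norm_lt.
  - exact: (measurable_preimage (measurable_couple_start N) (mg _)).
  - move=> x /= xr; split; first exact: quant_quant.
    rewrite (le_lt_trans (quant_norm_le _ _))// mul0r mul0r addr0.
    exact: (ltr_leD xr (N1 _ N20)).
set b := r + 1 + l%:R / N%:R * (M + 1) in IH.
have mB := @measurable_norm_lt R n M.
apply: (@prob1_subset _ _ _ (noisy Vbar (couple Vbar mu0 N l))
  ((fst @^-1` grid N b) `*` [set v : 'rV[R]_n | `|v| < M])).
- exact: measurableX.
- exact: (measurable_preimage (measurable_couple_map _ _ _) (mg _)).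
- move=> [[x y] v] [[/= xq xb] /= vM]; split.
    (* A velocity of the form integer over [N], run for time [1/N], displaces by an integer over
       [N^2]. *)
    pose z k : int := Num.floor (x 0 k * (N ^ 2)%:R) + Num.floor (v 0 k * N%:R).
    apply: (@quant_id _ _ _ z) => // k; rewrite !mxE (quant_fixed xq) /z intrD.
    by rewrite mulrDl natrX; congr (_ + _); field; rewrite pnatr_eq0 -lt0n.
  rewrite (le_lt_trans (ler_normD _ _))// normrZ gtr0_norm ?invr_gt0 ?ltr0n//.
  have -> : r + 1 + l.+1%:R / N%:R * (M + 1) = b + N%:R^-1 * (M + 1).
    by rewrite /b -natr1 mulrDl mulrDl mul1r addrA.
  rewrite ltr_leD// ler_pM2l ?invr_gt0 ?ltr0n//.
  by rewrite (le_trans (quant_norm_le _ N0))// lerD// ?N1// ltW.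
- by rewrite noisyX// VbarM IH mule1.
Qed.

Definition las (N : nat) (s : R) : Pr R n :=
  let l := Num.truncn (s * N%:R) in
  image_prob (couple_step Vbar N (s - l%:R / N%:R) (couple Vbar mu0 N l))
    (@measurable_fst _ _ (Rn R n) (Rn R n)).

Lemma lasE N l t A : (0 < N)%N -> 0 <= t <= N%:R^-1 -> measurable A ->
  las N (l%:R / N%:R + t) A =
  couple_step Vbar N t (couple Vbar mu0 N l) (fst @^-1` A).
Proof.
move=> N0 /andP[t0 tN] mA; have N0' : 0 < N%:R :> R by rewrite ltr0n.
have mfA : measurable (fst @^-1` A : set (Rn R n * Rn R n)).
  exact: (measurable_fst_preimage mA).
move: tN; rewrite le_eqVlt => /orP[/eqP ->|tN].
  (* At [t = 1/N] the truncation in [las] jumps to [l.+1] with remaining time 0; a step of length 0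
     changes nothing, and [couple] at [l.+1] is by definition the full step from [l]. *)
  rewrite -[X in _ / _ + X]mul1r -mulrDl natr1 /las divfK ?lt0r_neq0//.
  by rewrite natrK subrr [LHS]couple_step0.
rewrite /las.
have -> : Num.truncn ((l%:R / N%:R + t) * N%:R) = l.
  apply: truncn_def; rewrite mulrDl divfK ?lt0r_neq0//.
  rewrite lerDl mulr_ge0 ?ler0n//= -natr1 ltrD2l.
  by rewrite -ltr_pdivlMr// div1r.
by rewrite addrC addKr.
Qed.

Lemma las_knotE N l A : (0 < N)%N -> measurable A ->
  las N (l%:R / N%:R) A = couple Vbar mu0 N l (fst @^-1` A).
Proof.
move=> N0 mA; rewrite -[X in las N X]addr0 lasE ?lexx ?invr_ge0 ?ler0n//.
rewrite couple_step0//.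
exact: (measurable_fst_preimage mA).
Qed.

(** The two lower bounds on [N] keep the positions up to time [T], respectively the velocities,
    almost surely inside their grids, so no mass is lost in the finite sums. *)
Lemma las_is_LAS N (T : R) : (0 < N)%N -> 0 <= T -> 0 < M -> 0 < r ->
  r + 1 + T * (M + 1) <= N%:R -> M <= N%:R ->
  is_LAS (product_PVF Vbar) mu0 T N (las N).
Proof.
move=> N0 T0 M0 r0 rN MN; have N20 : (0 < N ^ 2)%N by rewrite expn_gt0 N0.
have rN' : r <= N%:R.
  apply: le_trans rN; rewrite -addrA lerDl addr_ge0// mulr_ge0//.
  by rewrite addr_ge0// ltW.
split=> // [A mA|l t tN ltT A mA].
  rewrite -[X in las N X](mul0r N%:R^-1) -[X in las N (X * _)]/(0%:R) las_knotE//.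
  rewrite -[LHS]/(mu0 (quant (N ^ 2) @^-1` A)).
  rewrite /LAS_init -natrX.
  apply: discrete_law => //.
  - by move=> i; exact: measurable_cell.
  - move=> i j _ _ [x [/= xi xj]]; apply: cell_disjoint xi xj => //.
  - apply: prob1_subset mu0r => //; first exact: measurable_norm_lt.
      by apply: fin_bigcup_measurable => // i _; exact: measurable_cell.
    move=> x /= xr; have [|i xi] := @lattice_cell R n N (N ^ 2) x N20.
      by rewrite (le_trans (ltW xr)).
    by exists i.
  - exact: measurable_quant.
  - by move=> i x; exact: cell_quant.
rewrite lasE// /LAS_step.
set g := couple Vbar mu0 N l.
(* Pieces on which the new position of the scheme is constant: its old position is an atom, the
   velocity ranges over a cell, and the coupled flow is left free. *)
pose E (ij : xgrid n N * vgrid n N) : set (Rn R n * Rn R n * Rn R n) :=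
  (fst @^-1` [set lattice_pt R ij.1]) `*` cell N%:R^-1 (lattice_pt R ij.2).
have m1 (i : xgrid n N) :
    measurable (fst @^-1` [set lattice_pt R i] : set (Rn R n * Rn R n)).
  exact: (measurable_fst_preimage (@measurable_rV1 R n (lattice_pt R i))).
have -> : couple_step Vbar N t g (fst @^-1` A) =
  noisy Vbar g ((fun p => (p.1.1 : 'rV[R]_n) + t *: quant N p.2) @^-1` A) by [].
rewrite (@discrete_law _ _ _ _ _ _ _ E _
  (fun ij => lattice_pt R ij.1 + t *: lattice_pt R ij.2 : Rn R n)) //.
- rewrite pair_big/=; apply: eq_bigr => -[i j] _ /=; congr (_ * _)%E.
  rewrite [LHS]noisyX//; last exact: measurable_cell.
  rewrite -las_knotE//; last exact: measurable_rV1.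
  rewrite -[LHS]product_measure1E//; last 2 first.
  - exact: measurable_rV1.
  - exact: measurable_cell.
- by move=> [i j]; apply: measurableX => //; exact: measurable_cell.
- move=> [i j] [i' j'] _ _ [[[x y] v] [[/= xi vj] [/= xi' vj']]].
  by rewrite (cell_disjoint N0 vj vj') (lattice_pt_inj N20 (etrans (esym xi) xi')).
- apply: (@prob1_subset _ _ _ (noisy Vbar g)
    ((fst @^-1` grid N (r + 1 + l%:R / N%:R * (M + 1))) `*`
      [set v : 'rV[R]_n | `|v| < M])).
  + apply: measurableX; last exact: measurable_norm_lt.
    exact: (measurable_fst_preimage (measurable_grid N _)).
  + apply: fin_bigcup_measurable => // -[i j] _.
    by apply: measurableX => //; exact: measurable_cell.
  + move=> [[x y] v] [[/= xq xb] /= vM].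
    have [|i xi] := @lattice_cell R n N (N ^ 2) x N20.
      rewrite (le_trans (ltW xb))// (le_trans _ rN)// lerD2l ler_wpM2r//.
        by rewrite addr_ge0// ltW.
      by rewrite (le_trans _ ltT)// lerDl; have /andP[] := tN.
    have [|j vj] := @lattice_cell R n N N v N0; first by rewrite (le_trans (ltW vM)).
    (* A position fixed by the rounding equals the corner of its cell, which upgrades membership in
       the cell to equality with the atom. *)
    by exists (i, j) => //; split => //=; rewrite -xq; exact: cell_quant.
  + rewrite noisyX ?VbarM ?couple_grid ?mule1//; last exact: measurable_norm_lt.
    exact: (measurable_fst_preimage (measurable_grid N _)).
- by have /measurable_fun_pairP[] := @measurable_couple_map R n Vbar N t.
- by move=> [i j] [[x y] v] [/= -> /(cell_quant N0) ->].
Qed.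

End lattice_curve.

(** * Mean-square distance of the coupling *)

Section mean_square.
Context (R : realType) (n : nat) (Vbar mu0 : Pr R n) (M : R).
Hypothesis VbarM : Vbar [set v : 'rV[R]_n | `|v| < M] = 1%E.
Let w := mean Vbar.

Definition mean_square (g : PrT R n) (k : 'I_n) : \bar R :=
  (\int[g]_p (((p.1 : 'rV[R]_n) 0 k - (p.2 : 'rV[R]_n) 0 k) ^+ 2)%:E)%E.

Lemma measurable_coord_quant N k :
  measurable_fun [set: Rn R n] (fun v : Rn R n => quant N v 0 k).
Proof.
apply: (measurableT_comp (@measurable_coord R n k)).
exact: measurable_quant.
Qed.

Lemma measurable_noise N k :
  measurable_fun [set: Rn R n] (fun v : Rn R n => quant N v 0 k - w 0 k).
Proof. by apply: measurable_funB => //; exact: measurable_coord_quant. Qed.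

(** Since [w] is the mean of the unrounded velocity, the bias is exactly the mean rounding error. *)
Lemma noise_mean N k : (0 < N)%N ->
  `|\int[Vbar]_v (quant N v 0 k - w 0 k)| <= N%:R^-1.
Proof.
move=> N0.
have iq : Vbar.-integrable setT (EFin \o (fun v : Rn R n => quant N v 0 k)).
  apply: (as_bounded_integrable (C := M + N%:R^-1)) VbarM _ _ => /=.
  - exact: measurable_norm_lt.
  - exact: measurable_coord_quant.
  - move=> v /= vM; rewrite (le_trans (coord_norm_le _ _))//.
    by rewrite (le_trans (quant_norm_le _ N0))// lerD2r ltW.
have -> : \int[Vbar]_v (quant N v 0 k - w 0 k) =
    \int[Vbar]_v (quant N v 0 k - (v : 'rV[R]_n) 0 k).
  rewrite RintegralB//; last exact: finite_measure_integrable_cst.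
  rewrite RintegralB//; last exact: (integrable_coord VbarM).
  by rewrite Rintegral_cst// [X in fine X]probability_setT mulr1 mxE.
apply: le_normr_Rintegral_bound => [|v]; last exact: quant_close.
by apply: measurable_funB; [exact: measurable_coord_quant|exact: measurable_coord].
Qed.

Lemma noise_bounded N k (v : 'rV[R]_n) : (0 < N)%N -> `|v| < M ->
  `|quant N v 0 k - w 0 k| <= M + 1 + `|w|.
Proof.
move=> N0 vM; rewrite (le_trans (ler_normB _ _))// lerD ?coord_norm_le//.
rewrite (le_trans (coord_norm_le _ _))// (le_trans (quant_norm_le _ N0))//.
by rewrite lerD// ?(ltW vM)// invf_le1 ?ltr0n// ler1n.
Qed.

Lemma measurable_sqdist k : measurable_fun [set: Rn R n * Rn R n]
  (fun p : Rn R n * Rn R n => (((p.1 : 'rV[R]_n) 0 k - (p.2 : 'rV[R]_n) 0 k) ^+ 2)).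
Proof.
apply: measurable_funX; apply: measurable_funB.
  exact: (measurableT_comp (@measurable_coord R n k)).
exact: (measurableT_comp (@measurable_coord R n k)).
Qed.

Lemma couple_step_mean_square N t (g : PrT R n) k : (0 < N)%N -> 0 <= t ->
  (mean_square (couple_step Vbar N t g) k <=
   (1 + t * N%:R^-1)%:E * mean_square g k +
   (t * N%:R^-1 + t ^+ 2 * (M + 1 + `|w|) ^+ 2)%:E)%E.
Proof.
move=> N0 t0; set c1 := 1 + _; set c2 := t * _ + _.
have c10 : 0 <= c1 by rewrite addr_ge0// mulr_ge0// invr_ge0.
have c20 : 0 <= c2 by rewrite addr_ge0// mulr_ge0// ?invr_ge0// sqr_ge0.
have mf := (measurable_EFinP _ _).2 (measurable_sqdist k).
have mh := measurableT_comp mf (@measurable_couple_map R n Vbar N t).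
(* The new difference is the old one plus [t] times the noise. [F] is the expectation over the
   velocity with positions frozen; nonnegativity allows Tonelli before any finiteness of the mean
   square is known. *)
pose F (p : Rn R n * Rn R n) : \bar R := (\int[Vbar]_v
  (((p.1 : 'rV[R]_n) 0 k - (p.2 : 'rV[R]_n) 0 k +
    t * (quant N v 0 k - w 0 k)) ^+ 2)%:E)%E.
have FE : fubini_F Vbar ((EFin \o (fun p : Rn R n * Rn R n =>
    ((p.1 : 'rV[R]_n) 0 k - (p.2 : 'rV[R]_n) 0 k) ^+ 2)) \o
    @couple_map R n Vbar N t) = F.
  apply/funext => p; apply: eq_integral => v _ /=; congr EFin.
  by rewrite /couple_map/= !mxE; ring.
have mF : measurable_fun setT F.
  rewrite -FE; apply: measurable_fun_fubini_tonelli_F => //.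
  by move=> p; rewrite lee_fin sqr_ge0.
have -> : mean_square (couple_step Vbar N t g) k = (\int[g]_p F p)%E.
  rewrite [LHS](ge0_integral_pushforward (@measurable_couple_map R n Vbar N t))//;
    last by move=> p _; rewrite lee_fin sqr_ge0.
  rewrite preimage_setT [LHS](fubini_tonelli1 _ mh) ?FE//.
  by move=> p; rewrite lee_fin sqr_ge0.
have -> : (c1%:E * mean_square g k + c2%:E =
  \int[g]_p (c1%:E * (((p.1 : 'rV[R]_n) 0 k - (p.2 : 'rV[R]_n) 0 k) ^+ 2)%:E + c2%:E))%E.
  rewrite ge0_integralD//; last 2 first.
  - by move=> p _; rewrite -EFinM lee_fin mulr_ge0// sqr_ge0.
  - exact: measurable_funeM.
  rewrite ge0_integralZl//; last by move=> p _; rewrite lee_fin sqr_ge0.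
  by rewrite integral_cst// [X in (_ + _ * X)%E]probability_setT mule1.
apply: ge0_le_integral => //.
- by move=> p _; apply: integral_ge0 => v _; rewrite lee_fin sqr_ge0.
- by apply: emeasurable_funD => //; exact: measurable_funeM.
move=> p _; rewrite -EFinM -EFinD.
apply: (@noise_second_moment _ (Rn R n) R Vbar _ [set v : 'rV[R]_n | `|v| < M]) => //.
- exact: measurable_norm_lt.
- exact: measurable_noise.
- by move=> v; exact: noise_bounded.
- exact: noise_mean.
Qed.

(** With [u = K / N^2], each step adds at most [u]: the factor [1 + t/N] applied to a quantity at
    most 1 costs [1/N^2], the bias another [1/N^2], and the variance [(M + 1 + |w|)^2 / N^2]. This
    is the origin of the lower bound on [K]. *)
Lemma couple_mean_square N l k (K : R) : (0 < N)%N ->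
  2 + (M + 1 + `|w|) ^+ 2 <= K -> l.+1%:R * (K / N%:R ^+ 2) <= 1 ->
  (mean_square (couple Vbar mu0 N l) k <= (l.+1%:R * (K / N%:R ^+ 2))%:E)%E /\
  forall t, 0 <= t <= N%:R^-1 ->
    (mean_square (couple_step Vbar N t (couple Vbar mu0 N l)) k <=
     (l.+2%:R * (K / N%:R ^+ 2))%:E)%E.
Proof.
move=> N0 HK; set u := K / _.
have N0' : 0 < N%:R :> R by rewrite ltr0n.
have K0 : 2 <= K by rewrite (le_trans _ HK)// lerDl sqr_ge0.
have u0 : 0 <= u by rewrite divr_ge0 ?sqr_ge0// (le_trans _ K0).
have step j : j.+1%:R * u <= 1 ->
    (mean_square (couple Vbar mu0 N j) k <= (j.+1%:R * u)%:E)%E ->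
    forall t, 0 <= t <= N%:R^-1 ->
    (mean_square (couple_step Vbar N t (couple Vbar mu0 N j)) k <=
     (j.+2%:R * u)%:E)%E.
  move=> ju1 IH t /andP[t0 tN].
  rewrite (le_trans (couple_step_mean_square _ _ N0 t0))//.
  set c1 := 1 + _; set c2 := t * _ + _.
  have c10 : 0 <= c1 by rewrite addr_ge0// mulr_ge0// invr_ge0.
  rewrite (@le_trans _ _ (c1%:E * (j.+1%:R * u)%:E + c2%:E)%E)//.
    by rewrite leeD2r// lee_pmul// integral_ge0// => p _; rewrite lee_fin sqr_ge0.
  rewrite -EFinM -EFinD lee_fin -[j.+2%:R]natr1 mulrDl mul1r /c1 mulrDl mul1r.
  rewrite -addrA lerD2l.
  have tN2 : t * N%:R^-1 <= N%:R^-1 ^+ 2.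
    by rewrite expr2 ler_wpM2r// invr_ge0.
  have t2N2 : t ^+ 2 <= N%:R^-1 ^+ 2 by rewrite lerXn2r ?nnegrE// (le_trans t0).
  apply: (@le_trans _ _ (N%:R^-1 ^+ 2 * (2 + (M + 1 + `|w|) ^+ 2))); last first.
    by rewrite /u -exprVn mulrC ler_wpM2r// sqr_ge0.
  rewrite mulrDr [_ * 2]mulrDr mulr1 -addrA; apply: lerD; last apply: lerD => //.
    rewrite -[leRHS]mulr1; apply: ler_pM => //; first by rewrite mulr_ge0// invr_ge0.
    by rewrite mulr_ge0.
  by rewrite ler_wpM2r// sqr_ge0.
(* Initially the difference is the rounding error of mesh [1/N^2], whose square [1/N^4] is below
   [u]. *)
have base : (mean_square (couple Vbar mu0 N 0) k <= (1%:R * u)%:E)%E.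
  rewrite [leLHS](ge0_integral_pushforward (measurable_couple_start N))//; last 2 first.
  - by apply/measurable_EFinP; exact: measurable_sqdist.
  - by move=> p _; rewrite lee_fin sqr_ge0.
  rewrite preimage_setT mul1r -[leRHS]mule1 -(probability_setT mu0).
  rewrite -[leRHS]integral_cst//; apply: ge0_le_integral => //.
  - by move=> x _; rewrite lee_fin sqr_ge0.
  - apply: measurableT_comp; last exact: measurable_couple_start.
    by apply/measurable_EFinP; exact: measurable_sqdist.
  move=> x _; rewrite /= lee_fin -real_normK ?num_real//.
  have N20 : (0 < N ^ 2)%N by rewrite expn_gt0 N0.
  rewrite (@le_trans _ _ ((N ^ 2)%:R^-1 ^+ 2))//.
    by rewrite lerXn2r ?nnegrE ?invr_ge0// quant_close.
  rewrite /u -natrX -[leLHS]mul1r expr2 mulrA ler_wpM2r ?invr_ge0//.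
  rewrite mul1r (@le_trans _ _ 1)//; last by rewrite (le_trans _ K0)// ler1n.
  by rewrite invf_le1 ?ltr0n// ler1n.
have main j : j.+1%:R * u <= 1 ->
    (mean_square (couple Vbar mu0 N j) k <= (j.+1%:R * u)%:E)%E.
  elim: j => [//|j IH] ju.
  have ju' : j.+1%:R * u <= 1.
    by rewrite (le_trans _ ju)// ler_wpM2r// ler_nat.
  apply: step => //; first exact: IH.
  by rewrite lexx invr_ge0 ler0n.
by move=> lu; split; [exact: main|apply: step => //; exact: main].
Qed.
End mean_square.

(** * Convergence *)

(* [u <= delta + u^2 / delta] replaces the Cauchy-Schwarz inequality here. *)
Lemma W1_le_mean_square (R : realType) (n : nat) (mu nu : Pr R n)
    (g : PrT R n) (b delta : R) :
  eq_meas (pushforward g fst) mu -> eq_meas (pushforward g snd) nu ->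
  (forall k, (mean_square g k <= b%:E)%E) -> 0 < delta ->
  (W1 mu nu <= (delta + n%:R * b / delta)%:E)%E.
Proof.
move=> g1 g2 gb d0.
apply: (@le_trans _ _ (\int[g]_p (enorm (p.1 - p.2))%:E)%E).
  by apply: ereal_inf_lbound; exists g.
pose sq k (p : Rn R n * Rn R n) : \bar R :=
  (((p.1 : 'rV[R]_n) 0 k - (p.2 : 'rV[R]_n) 0 k) ^+ 2)%:E.
have msq k : measurable_fun setT (sq k).
  by apply/measurable_EFinP; exact: measurable_sqdist.
have sq0 k p : (0 <= sq k p)%E by rewrite lee_fin sqr_ge0.
have mS : measurable_fun setT (fun p => \sum_(k < n) sq k p)%E.
  exact: emeasurable_sum.
have S0 p : (0 <= \sum_(k < n) sq k p)%E by exact: sume_ge0.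
apply: (@le_trans _ _
    (\int[g]_p (delta%:E + delta^-1%:E * \sum_(k < n) sq k p))%E).
  apply: ge0_le_integral => //.
  - by move=> p _; rewrite lee_fin sqrtr_ge0.
  - apply/measurable_EFinP; apply: measurable_enormB.
      exact: measurable_fst.
    exact: measurable_snd.
  - by apply: emeasurable_funD => //; exact: measurable_funeM.
  move=> p _; rewrite /sq sumEFin -EFinM -EFinD lee_fin.
  have -> : \sum_(k < n) ((p.1 : 'rV[R]_n) 0 k - (p.2 : 'rV[R]_n) 0 k) ^+ 2 =
      enorm ((p.1 : 'rV[R]_n) - p.2) ^+ 2.
    rewrite sqr_sqrtr; last by apply: sumr_ge0 => k _; exact: sqr_ge0.
    by apply: eq_bigr => k _; rewrite !mxE.
  set u := enorm _; have u0 : 0 <= u by exact: sqrtr_ge0.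
  rewrite -(ler_pM2l d0) mulrDr mulrA divff ?lt0r_neq0// mul1r.
  have [ud|du] := leP u delta; first by nra.
  by nra.
have d0' : (0 <= delta^-1%:E :> \bar R)%E by rewrite lee_fin invr_ge0 ltW.
rewrite ge0_integralD//; last 3 first.
- by move=> p _; rewrite lee_fin ltW.
- by move=> p _; rewrite mule_ge0.
- exact: measurable_funeM.
rewrite integral_cst// [X in (_ * X + _)%E]probability_setT mule1 EFinD.
rewrite leeD2l// ge0_integralZl// ge0_integral_sum//.
rewrite mulrC EFinM lee_pmul//.
  by apply: sume_ge0 => k _; exact: integral_ge0.
rewrite (@le_trans _ _ (\sum_(k < n) b%:E)%E)//.
  by apply: lee_sum => k _; exact: gb.
by rewrite sumEFin lee_fin sumr_const card_ord mulr_natl.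
Qed.

Section lattice_limit.
Context (R : realType) (n : nat) (Vbar mu0 : Pr R n) (M r T : R).
Hypothesis VbarM : Vbar [set v : 'rV[R]_n | `|v| < M] = 1%E.
Hypothesis mu0r : mu0 [set x : 'rV[R]_n | `|x| < r] = 1%E.
Hypotheses (M0 : 0 < M) (r0 : 0 < r) (T0 : 0 < T).
Let w := mean Vbar.

Lemma las_cvg (eps : R) : 0 < eps -> exists N0 : nat, forall N, (N0 <= N)%N ->
  is_LAS (product_PVF Vbar) mu0 T N (las Vbar mu0 N) /\
  forall t, 0 <= t <= T ->
    (W1 (las Vbar mu0 N t) (translate mu0 (t *: w)) <= eps%:E)%E.
Proof.
move=> e0; pose K := 2 + (M + 1 + `|w|) ^+ 2.
have K0 : 0 < K by rewrite ltr_wpDr// sqr_ge0.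
(* [N >= B1] and [N >= M] keep the mass in the grids. At most [T * N] full steps occur, so the mean
   square per coordinate is at most [B2 / N], which [N >= B2] makes at most 1. [N >= B3] bounds the
   second half of the [W1] estimate taken with [delta = eps / 2]. *)
pose B1 := r + 1 + T * (M + 1); pose B2 := (T + 2) * K.
pose B3 := n%:R * ((T + 2) * K) / (eps / 2) ^+ 2.
have [T0' M0' r0' K0'] := And4 (ltW T0) (ltW M0) (ltW r0) (ltW K0).
have B10 : 0 <= B1 by rewrite !addr_ge0 ?mulr_ge0 ?addr_ge0.
have B20 : 0 <= B2 := mulr_ge0 (addr_ge0 T0' (ler0n _ 2)) K0'.
have B30 : 0 <= B3 by rewrite divr_ge0 ?sqr_ge0 ?(mulr_ge0 (ler0n _ n) B20).
have Bge0 := addr_ge0 (addr_ge0 (addr_ge0 B10 M0') B20) B30.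
exists (Num.bound (B1 + M + B2 + B3)).+1 => N BN.
have N0 : (0 < N)%N by exact: leq_trans BN.
have N0' : 0 < N%:R :> R by rewrite ltr0n.
have BNr : B1 + M + B2 + B3 <= N%:R.
  rewrite (le_trans (ltW (archi_boundP Bge0)))// ler_nat.
  exact: leq_trans (leqnSn _) BN.
have [B1N MN B2N B3N] : [/\ B1 <= N%:R, M <= N%:R, B2 <= N%:R & B3 <= N%:R].
  by move: M0; split; lra.
split; first exact: (las_is_LAS VbarM mu0r).
move=> t /andP[t0 tT].
pose l := Num.truncn (t * N%:R).
have tN0 : 0 <= t * N%:R by rewrite mulr_ge0.
have /andP[lt tl] := truncn_itv tN0; rewrite -/l in lt tl.
pose s := t - l%:R / N%:R.
have s0 : 0 <= s by rewrite subr_ge0 ler_pdivrMr.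
have sN : s <= N%:R^-1.
  rewrite lerBlDr -[X in X + _]mul1r -mulrDl ler_pdivlMr// addrC natr1.
  exact: ltW.
have lT : l.+2%:R / N%:R <= T + 2.
  rewrite -[l.+2]addn2 natrD mulrDl lerD//.
    by rewrite (le_trans _ tT)// ler_pdivrMr.
  by rewrite ler_pdivrMr// ler_peMr// ler1n.
pose b := l.+2%:R * (K / N%:R ^+ 2).
have bE : b = l.+2%:R / N%:R * K / N%:R by rewrite /b; field; rewrite lt0r_neq0.
have bB : b <= B2 / N%:R.
  by rewrite bE ler_wpM2r ?invr_ge0// ler_wpM2r// ltW.
have b1 : b <= 1.
  by rewrite (le_trans bB)// ler_pdivrMr// mul1r.
have lb1 : l.+1%:R * (K / N%:R ^+ 2) <= 1.
  rewrite (le_trans _ b1)// ler_wpM2r ?ler_nat//.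
  by rewrite divr_ge0 ?sqr_ge0// ltW.
have gb k := (couple_mean_square mu0 VbarM k N0 (lexx K) lb1).2 s.
have e20 : 0 < eps / 2 by rewrite divr_gt0.
have tE : l%:R / N%:R + s = t by rewrite /s subrKC.
rewrite (le_trans (@W1_le_mean_square R n (las Vbar mu0 N t) (translate mu0 (t *: w))
  (couple_step Vbar N s (couple Vbar mu0 N l)) b (eps / 2) _ _ _ e20))//.
- by move=> A mA; rewrite -tE couple_step_couple_snd.
- by move=> k; apply: gb; rewrite s0.
rewrite lee_fin [leRHS]splitr lerD2l ler_pdivrMr// -expr2.
rewrite (@le_trans _ _ (n%:R * (B2 / N%:R)))// ?ler_wpM2l//.
by rewrite mulrA ler_pdivrMr// [leRHS]mulrC -ler_pdivrMr ?exprn_gt0.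
Qed.

End lattice_limit.

(** Induction over the knots [l / N], then one partial step. Agreement on measurable sets is
    propagated by [pvf_ext], since [LAS_step] evaluates [V] only on products of a point and a cell,
    which are measurable. *)
Lemma is_LAS_unique (R : realType) (n : nat) (V : PVF R n) (mu0 : Pr R n)
    (T : R) (N : nat) (mu nu : R -> Pr R n) :
  is_LAS V mu0 T N mu -> is_LAS V mu0 T N nu ->
  forall t, 0 <= t <= T -> eq_meas (mu t) (nu t).
Proof.
move=> [N0 mu_0 muS] [_ nu_0 nuS].
have N0' : 0 < N%:R :> R by rewrite ltr0n.
have stepE (rho rho' : Pr R n) t (A : set (Rn R n)) : eq_meas rho rho' ->
    LAS_step V N rho t A = LAS_step V N rho' t A.
  move=> rr; apply: eq_bigr => i _; apply: eq_bigr => j _; congr (_ * _)%E.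
  apply: (pvf_ext V rr).
  have -> : [set p : Rn R n * Rn R n | p.1 = lattice_pt R i /\
      cell N%:R^-1 (lattice_pt R j) p.2] =
      [set lattice_pt R i] `*` cell N%:R^-1 (lattice_pt R j) by [].
  by apply: measurableX; [exact: measurable_rV1|exact: measurable_cell].
have knot l : l%:R / N%:R <= T ->
    eq_meas (mu (l%:R / N%:R)) (nu (l%:R / N%:R)).
  elim: l => [_|l IH lT] A mA; first by rewrite mul0r mu_0// nu_0.
  have lE : l.+1%:R / N%:R = l%:R / N%:R + N%:R^-1 :> R.
    by rewrite -natr1 mulrDl mul1r.
  rewrite lE in lT *; rewrite muS ?nuS ?invr_ge0 ?lexx ?ler0n//.
  apply: stepE; apply: IH; rewrite (le_trans _ lT)// lerDl invr_ge0//.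
move=> t /andP[t0 tT] A mA.
pose l := Num.truncn (t * N%:R).
have tN0 : 0 <= t * N%:R by rewrite mulr_ge0.
have /andP[lt tl] := truncn_itv tN0; rewrite -/l in lt tl.
pose s := t - l%:R / N%:R.
have s0 : 0 <= s by rewrite subr_ge0 ler_pdivrMr.
have sN : s <= N%:R^-1.
  rewrite lerBlDr -[X in X + _]mul1r -mulrDl ler_pdivlMr// addrC natr1.
  exact: ltW.
have tE : t = l%:R / N%:R + s by rewrite /s subrKC.
rewrite tE in tT *; rewrite muS ?nuS ?s0//; apply: stepE; apply: knot.
by rewrite (le_trans _ tT)// lerDl.
Qed.

Lemma W1_eq_meas (R : realType) (n : nat) (mu mu' nu : Pr R n) :
  eq_meas mu mu' -> W1 mu nu = W1 mu' nu.
Proof.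
move=> mm; rewrite /W1; congr (ereal_inf _); apply/seteqP.
split=> _ [g [g1 g2] <-]; exists g => //; split=> // A mA.
  by rewrite g1// mm.
by rewrite g1// mm.
Qed.

Theorem proposition7p1 (R : realType) (n : nat) (Vbar : Pr R n)
    (hVbar : compactly_supported Vbar) (mu0 : Pr R n)
    (hmu0 : compactly_supported mu0) (T : R) (hT : 0 < T) :
  (exists mu : R -> Pr R n, LAS_limit (product_PVF Vbar) mu0 T id mu) /\
  (forall (phi : nat -> nat) (mu : R -> Pr R n),
    {homo phi : k l / (k < l)%N} ->
    LAS_limit (product_PVF Vbar) mu0 T phi mu ->
    is_solution (product_PVF Vbar) mu0 T mu /\
    (forall t : R, 0 <= t <= T -> forall A : set 'rV[R]_n,
      measurable (A : set (Rn R n)) ->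
      mu t A = mu0 [set a - t *: mean Vbar | a in A])).
Proof.
have [M M0 VbarM] := compactly_supported_bounded hVbar.
have [r r0 mu0r] := compactly_supported_bounded hmu0.
have cvg := las_cvg VbarM mu0r M0 r0 hT.
split.
  exists (fun t => translate mu0 (t *: mean Vbar)).
  exists (fun k => las Vbar mu0 k); split.
    have [N0 N0P] := cvg 1 ltr01.
    by exists N0 => // k /= N0k; have [] := N0P k N0k.
  move=> eps /cvg[N0 N0P]; exists N0 => // k /= N0k.
  by have [] := N0P k N0k.
move=> phi mu phiS [muN [muN_LAS muN_mu]].
have phi_ge k : (k <= phi k)%N.
  by elim: k => // k IH; rewrite (leq_ltn_trans IH)//; exact: phiS.
have muE t : 0 <= t <= T -> eq_meas (mu t) (translate mu0 (t *: mean Vbar)).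
  (* The intermediate measure is [muN k t]: it is close to [mu t] by assumption, and close to the
     flow because it agrees with [las] at parameter [phi k >= k]. *)
  move=> tT; apply: W1_limit_unique => eps e0.
  have [N0 N0P] := cvg eps e0.
  have [k1 _ k1P] := muN_LAS; have [k2 _ k2P] := muN_mu eps e0.
  pose k := maxn N0 (maxn k1 k2); exists (muN k t); split.
    by apply: k2P => //=; rewrite /k !leq_max leqnn !orbT.
  have N0k : (N0 <= phi k)%N by rewrite (leq_trans _ (phi_ge k))// leq_maxl.
  have [las_LAS lasW] := N0P _ N0k.
  have kLAS : is_LAS (product_PVF Vbar) mu0 T (phi k) (muN k).
    by apply: k1P => /=; rewrite /k !leq_max leqnn !orbT.
  by rewrite (W1_eq_meas _ (is_LAS_unique kLAS las_LAS tT)) lasW.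
split; first exact: (translation_is_solution VbarM).
move=> t tT A mA; rewrite muE//; congr (mu0 _).
(* The preimage of [A] under the shift by [t *: mean Vbar] is its image under the inverse shift. *)
apply/seteqP; split=> [x /= Ax|_ [a Aa <-]].
  by exists (x + t *: mean Vbar) => //; rewrite addrK.
by rewrite /preimage/= subrK.
Qed.
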